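(* Let $G(x)=6x(1-x)$ on $[0,1]$ and $D=\{(x,y):0\leq x\leq1,\ 0\leq y\leq G(x)\}$. For $n\geq0$ let $p_n$ be the probability that $n$ independent uniform random points in $D$, together with $(0,0)$ and $(1,0)$, are in convex position (with $p_0=1$). Then for all $n\geq0$, \[p_n=\frac{12^{n+1}}{6\,(2n+2)!}.\]
   Context: A finite set of points is in convex position if it is the vertex set of a convex polygon. *)

(* Defs.v *)
From HB Require Import structures.
From mathcomp Require Import all_boot all_order all_algebra.
From mathcomp Require Import all_classical all_reals all_analysis.
Set Implicit Arguments.
Unset Strict Implicit.
Unset Printing Implicit Defensive.
Import Order.TTheory GRing.Theory Num.Theory numFieldNormedType.Exports.
Local Open Scope classical_set_scope.
Local Open Scope convex_scope.
Local Open Scope ring_scope.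

Definition convex_hull (R : realType) (S : set (R * R)) : set (R * R) :=
  [set z | forall C : set (convex_lmodType (R * R)%type),
     convex_set C -> S `<=` C -> C z].

(* A convex polygon is two-dimensional: points and segments are excluded. *)
Definition convex_polygon (R : realType) (Q : set (R * R)) : Prop :=
  (exists F : set (R * R), finite_set F /\ Q = convex_hull F) /\
  Q° !=set0.

(* The vertices of a polygon are its extreme points. In particular a point in
   the relative interior of an edge is not a vertex. *)
Definition vertex_set (R : realType) (Q : set (R * R)) : set (R * R) :=
  [set v | Q v /\
    forall (a b : convex_lmodType (R * R)%type) (t : {i01 R}),
      Q a -> Q b -> 0 < t%:num -> t%:num < 1 -> v = a <| t |> b ->
      a = v /\ b = v].

Definition in_convex_position (R : realType) (S : set (R * R)) : Prop :=
  finite_set S /\ exists2 Q : set (R * R), convex_polygon Q & S = vertex_set Q.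

Definition mutually_independent (R : realType) (d d' : measure_display)
    (Omega : measurableType d) (T : measurableType d') (P : probability Omega R)
    (I : finType) (X : I -> {RV P >-> T}) : Prop :=
  forall (J : {set I}) (A : I -> set T),
    (forall i, measurable (A i)) ->
    P (\bigcap_(i in [set` J]) (X i @^-1` A i)) =
    (\prod_(i in J) P (X i @^-1` A i))%E.

Definition uniform_in (R : realType) (d : measure_display)
    (Omega : measurableType d) (P : probability Omega R)
    (X : {RV P >-> (R * R)%type}) (K : set (R * R)) : Prop :=
  let area := (@lebesgue_measure R \x @lebesgue_measure R)%E in
  forall A : set (R * R), measurable A ->
    distribution P X A = (area (A `&` K) / area K)%E.

Definition G (R : realType) (x : R) : R := 6 * x * (1 - x).

Definition D (R : realType) : set (R * R) :=
  [set z | 0 <= z.1 <= 1 /\ 0 <= z.2 <= G z.1].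

(* The value at [n = 0] is a convention: the two points (0,0) and (1,0) alone
   are not the vertex set of a (two-dimensional) convex polygon. *)
Definition prob_convex (R : realType) (d : measure_display)
    (Omega : measurableType d) (P : probability Omega R) (n : nat)
    (X : 'I_n -> {RV P >-> (R * R)%type}) : \bar R :=
  if n == 0%N then 1%E else
  P [set w | in_convex_position
               ([set X i w | i in [set: 'I_n]] `|` [set (0, 0); (1, 0)])].

(* Main.v *)
(* The chain through the points is split at the point z maximizing y / G(x), the
   one hit first when the parabola is lowered as l * G. All other points lie below
   l * G, and by strict concavity of l * G at z the whole chain is concave if and
   only if the points to the left of z lie above the chord from (0,0) to z and form
   a concave chain over it, and likewise on the right. The two caps cut off by these
   chords are affine images of D of areas l x^3 and l (1-x)^3, so conditionally on z
   both sides are independent copies of the original problem. Integrating over z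
   gives, with m = n-1-k,
     p_n = 6 \sum_k C(n-1,k) (3k+1)! (3m+1)! / (3n)! p_k p_m,
   which for (3k+1)! p_k / (12^k k!) is the convolution identity B^2 * B^2 = B^4
   for the coefficients of the ternary tree series B = 1 + x B^3.
   Since P may be evaluated only on measurable sets, convex position is also
   characterized exactly, through strict separation by rational functionals. *)
Require Import Defs.
From HB Require Import structures.
From mathcomp Require Import all_boot all_order all_algebra.
From mathcomp Require Import all_classical all_reals all_analysis.
From mathcomp Require Import unstable measurable_realfun zify ring lra.
Set Implicit Arguments.
Unset Strict Implicit.
Unset Printing Implicit Defensive.
Import Order.TTheory GRing.Theory Num.Theory numFieldNormedType.Exports.
Local Open Scope classical_set_scope.
Local Open Scope ring_scope.

(** * Separation in the plane *)

(** The sample space is arbitrary, so conditioning on the split point is replaced by uniqueness of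
    laws: the probability of an event about the points is determined by the probabilities of boxes.
    It may therefore be computed on a product space where the split point, the points on its left
    and those on its right live on three separate factors, and there it is an iterated integral. The
    same principle shows that points required to land in [D] after rescaling follow a multiple of
    the original law. The induction runs over subsets of the index set, not over numbers. Which
    index is highest and which indices lie on its left define finitely many disjoint events, and the
    binomial coefficients appear only when these are summed. Chains are defined by strict
    inequalities inside the open cap. They agree with convex position only outside two null events:
    points on the boundary of [D], and ties between two points. *)

Definition dot {R : realType} (u v : R * R) : R := u.1 * v.1 + u.2 * v.2.

Section Hull.
Context {R : realType}.
Implicit Types (F C : set (R * R)) (a b u v : R * R).

Lemma convP C :
  (forall a b (t : R), 0 <= t <= 1 -> C a -> C b ->
     C (t * a.1 + (1 - t) * b.1, t * a.2 + (1 - t) * b.2)) ->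
  convex_set (C : set (convex_lmodType (R * R)%type)).
Proof.
move=> H a b t; rewrite !inE => Ca Cb.
by apply: (H a b t%:num) => //; rewrite ge0 le1.
Qed.

Lemma sub_hull F : F `<=` convex_hull F.
Proof. by move=> x Fx C _; apply. Qed.

Lemma hull_min F C : convex_set (C : set (convex_lmodType (R * R)%type)) ->
  F `<=` C -> convex_hull F `<=` C.
Proof. by move=> cC FC x; apply. Qed.

Lemma hull_mono F F' : F `<=` F' -> convex_hull F `<=` convex_hull F'.
Proof. by move=> FF' x Fx C cC F'C; apply: Fx => //; exact: subset_trans F'C. Qed.

Lemma hull_comb F a b (p q : R) : convex_hull F a -> convex_hull F b ->
  0 <= p -> 0 <= q -> p + q = 1 ->
  convex_hull F (p * a.1 + q * b.1, p * a.2 + q * b.2).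
Proof.
move=> Fa Fb p0 q0 pq C cC FC.
have p1 : p <= 1 by lra.
have -> : q = 1 - p by lra.
have := cC a b (Itv01 p0 p1); rewrite !inE => H.
by apply: H; [exact: Fa|exact: Fb].
Qed.

(** An open half-plane stays convex when a single boundary point is added, and that point is then
    extreme. This is how separation yields vertices. *)
Lemma below_convex u v :
  convex_set ([set x | x = v \/ dot u x < dot u v]
    : set (convex_lmodType (R * R)%type)).
Proof.
apply: convP => a b t /andP[t0 t1] /= Ha Hb.
have [->|tn0] := eqVneq t 0.
  by rewrite !mul0r !add0r subr0 !mul1r -surjective_pairing.
have [->|tn1] := eqVneq t 1.
  by rewrite !mul1r subrr !mul0r !addr0 -surjective_pairing.
have tp : 0 < t by rewrite lt_def tn0.
have tp1 : 0 < 1 - t by rewrite subr_gt0 lt_def eq_sym tn1.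
case: Ha Hb => [->|Ha] [->|Hb].
- by left; rewrite [RHS]surjective_pairing; congr pair; ring.
- by right; move: Hb; rewrite /dot /=; nra.
- by right; move: Ha; rewrite /dot /=; nra.
- by right; move: Ha Hb; rewrite /dot /=; nra.
Qed.

(** The points [a] and [b] lie on the line through [v] orthogonal to [u], on opposite sides of [v].
    The two cross products are their signed positions on it, up to a common scale, so exchanging
    them gives the weights of [v]. *)
Lemma hull_line F a b u v : convex_hull F a -> convex_hull F b ->
  0 < dot u u -> dot u a = dot u v -> dot u b = dot u v ->
  u.1 * (a.2 - v.2) - u.2 * (a.1 - v.1) >= 0 ->
  u.1 * (b.2 - v.2) - u.2 * (b.1 - v.1) <= 0 -> convex_hull F v.
Proof.
set c := _ - _; set c' := _ - _.
move=> Fa Fb; rewrite /dot => u0 ua ub c0 c'0.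
have [cc|cc] := eqVneq (c - c') 0.
  have c00 : c = 0 by lra.
  suff <- : a = v by [].
  rewrite [a]surjective_pairing [v]surjective_pairing.
  (* Multiplied by [dot u u], the coordinates of [a - v] are combinations of [dot u a - dot u v] and
     [c], which both vanish. *)
  have u0' : u.1 * u.1 + u.2 * u.2 != 0 by rewrite gt_eqF.
  congr pair; apply/eqP; rewrite -subr_eq0; apply/eqP; apply: (mulfI u0');
    rewrite mulr0.
    transitivity (u.1 * (u.1 * a.1 + u.2 * a.2 - (u.1 * v.1 + u.2 * v.2)) - u.2 * c).
      by rewrite /c; ring.
    by rewrite ua c00; ring.
  transitivity (u.2 * (u.1 * a.1 + u.2 * a.2 - (u.1 * v.1 + u.2 * v.2)) + u.1 * c).
    by rewrite /c; ring.
  by rewrite ua c00; ring.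
have ccp : 0 < c - c' by rewrite lt_def cc; lra.
have := @hull_comb F a b (- c' / (c - c')) (c / (c - c')) Fa Fb.
have u0' : u.1 * u.1 + u.2 * u.2 != 0 by rewrite gt_eqF.
have -> : (- c' / (c - c') * a.1 + c / (c - c') * b.1,
           - c' / (c - c') * a.2 + c / (c - c') * b.2) = v.
  rewrite [RHS]surjective_pairing.
  have Ea : u.1 * a.1 + u.2 * a.2 = u.1 * v.1 + u.2 * v.2 by [].
  congr pair; apply/eqP; rewrite -subr_eq0; apply/eqP; apply: (mulfI u0');
   apply: (mulfI cc); rewrite !mulr0.
    transitivity ((u.1 * u.1 + u.2 * u.2) * (c * (b.1 - v.1) - c' * (a.1 - v.1))).
      by field.
    transitivity (u.1 * (c * (u.1 * b.1 + u.2 * b.2 - (u.1 * v.1 + u.2 * v.2)) -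
      c' * (u.1 * a.1 + u.2 * a.2 - (u.1 * v.1 + u.2 * v.2)))).
      by rewrite /c /c'; ring.
    by rewrite ua ub; ring.
  transitivity ((u.1 * u.1 + u.2 * u.2) * (c * (b.2 - v.2) - c' * (a.2 - v.2))).
    by field.
  transitivity (u.2 * (c * (u.1 * b.1 + u.2 * b.2 - (u.1 * v.1 + u.2 * v.2)) -
      c' * (u.1 * a.1 + u.2 * a.2 - (u.1 * v.1 + u.2 * v.2)))).
    by rewrite /c /c'; ring.
  by rewrite ua ub; ring.
apply.
- by apply: divr_ge0; lra.
- by apply: divr_ge0; lra.
- by field.
Qed.

Lemma seq_argmax (T : eqType) (s0 : T) (s : seq T) (f : T -> R) :
  exists2 t, t \in s0 :: s & forall x, x \in s0 :: s -> f x <= f t.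
Proof.
elim: s s0 => [|s1 s IH] s0.
  by exists s0 => [|x]; rewrite inE// => /eqP ->.
have [t ts H] := IH s1.
have [le|lt] := leP (f s0) (f t).
  by exists t; [rewrite inE ts orbT|move=> x; rewrite inE => /orP[/eqP->//|/H]].
exists s0; first exact: mem_head.
move=> x; rewrite inE => /orP[/eqP->//|/H] h.
exact: le_trans h (ltW lt).
Qed.

(* Gordan's alternative in the plane. Adding a point t beyond the line u = const
   through v: every segment [s,t] meets that line, all on the same side of v, and
   tilting u towards this side separates t as well. *)
Lemma separation (F : seq (R * R)) v : ~ convex_hull [set` F] v ->
  exists u, forall t, t \in F -> dot u t < dot u v.
Proof.
elim: F => [|t F IH] nv; first by exists (0, 0).
have [u Hu] : exists u, forall t, t \in F -> dot u t < dot u v.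
  by apply: IH => h; apply: nv; apply: hull_mono h => x /= xF; rewrite inE xF orbT.
have hullt : convex_hull [set` t :: F] t by apply: sub_hull => /=; exact: mem_head.
have hulls s : s \in F -> convex_hull [set` t :: F] s.
  by move=> sF; apply: sub_hull => /=; rewrite inE sF orbT.
case: F => [|s0 F] in IH nv Hu hullt hulls *.
  have tv : t <> v by move=> tv; apply: nv; rewrite -tv.
  exists (v - t) => x; rewrite inE => /eqP ->.
  rewrite /dot/=.
  suff : (v.1 - t.1) != 0 \/ (v.2 - t.2) != 0.
    by move=> [|] /eqP h; rewrite -subr_gt0; move: h => /eqP h;
      (have : 0 < (v.1 - t.1) ^+ 2 + (v.2 - t.2) ^+ 2; [|lra]);
      [rewrite ltr_wpDr ?sqr_ge0// | rewrite ltr_wpDl ?sqr_ge0//];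
      rewrite lt_def sqr_ge0 sqrf_eq0 h.
  have [e1|e1] := eqVneq (v.1 - t.1) 0; last by left.
  right; apply/eqP => e2; apply: tv.
  by rewrite [t]surjective_pairing [v]surjective_pairing; congr pair; lra.
have [ut|ut] := ltP (dot u t) (dot u v).
  by exists u => x; rewrite inE => /orP[/eqP->//|]; exact: Hu.
pose tau := dot u t - dot u v; pose sg s := dot u v - dot u s.
have tau0 : 0 <= tau by rewrite /tau; lra.
have sg0 s : s \in s0 :: F -> 0 < sg s by move=> /Hu; rewrite /sg; lra.
have u0 : 0 < dot u u.
  have := sg0 _ (mem_head _ _); rewrite /sg /dot => h.
  have [e|e] := eqVneq u.1 0.
    have [e'|e'] := eqVneq u.2 0; first by move: h; rewrite e e'; lra.
    by rewrite ltr_wpDl -?expr2 ?sqr_ge0// lt_def sqr_ge0 sqrf_eq0 e'.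
  by rewrite ltr_wpDr -?expr2 ?sqr_ge0// lt_def sqr_ge0 sqrf_eq0 e.
pose cr (w s : R * R) := w.1 * (s.2 - v.2) - w.2 * (s.1 - v.1).
pose c s := tau * cr u s + sg s * cr u t.
(* The point where the segment from [s] to [t] meets the line [dot u x = dot u v]: the weights are
   the distances of [s] and [t] to that line, exchanged. *)
pose q (s : R * R) : R * R := (tau / (tau + sg s) * s.1 + sg s / (tau + sg s) * t.1,
               tau / (tau + sg s) * s.2 + sg s / (tau + sg s) * t.2).
have ts0 s : s \in s0 :: F -> 0 < tau + sg s by move=> /sg0; lra.
have hq s : s \in s0 :: F -> convex_hull [set` t :: s0 :: F] (q s).
  move=> sF; have := ts0 _ sF; have := sg0 _ sF => h1 h2.
  apply: hull_comb => //; [exact: hulls| | |].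
  - by apply: divr_ge0; lra.
  - by apply: divr_ge0; lra.
  - by field; rewrite gt_eqF.
have uq s : s \in s0 :: F -> dot u (q s) = dot u v.
  move=> sF; have h2 := ts0 _ sF; have h3 : tau + sg s != 0 by rewrite gt_eqF.
  rewrite /dot /=; apply: (mulfI h3).
  transitivity (tau * dot u s + sg s * dot u t); first by rewrite /dot; field.
  by rewrite -/(dot u v) /tau /sg; ring.
have cq s : s \in s0 :: F -> c s = (tau + sg s) * cr u (q s).
  move=> sF; have h2 := ts0 _ sF; have h3 : tau + sg s != 0 by rewrite gt_eqF.
  by rewrite /c /cr /q /=; field.
have side : (forall s, s \in s0 :: F -> c s < 0) \/
            (forall s, s \in s0 :: F -> 0 < c s).
  have [a1|/existsNP[s1 /not_implyP[m1 /negP]]] :=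
    pselect (forall s, s \in s0 :: F -> c s < 0); first by left.
  rewrite -leNgt => h1.
  have [a2|/existsNP[s2 /not_implyP[m2 /negP]]] :=
    pselect (forall s, s \in s0 :: F -> 0 < c s); first by right.
  rewrite -leNgt => h2; exfalso; apply: nv.
  apply: (hull_line (hq _ m1) (hq _ m2) u0 (uq _ m1) (uq _ m2)).
    by move: h1; rewrite (cq _ m1) pmulr_rge0// ts0.
  by move: h2; rewrite (cq _ m2) pmulr_rle0// ts0.
(* [w] is [u] turned by a right angle, oriented away from the side of [v] where the crossing points
   lie. *)
have [w Hw] : exists w : R * R, forall s, s \in s0 :: F ->
    tau * (dot w s - dot w v) + sg s * (dot w t - dot w v) < 0.
  case: side => H; [exists (- u.2, u.1)|exists (u.2, - u.1)] => s /H;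
   by rewrite /c /cr /dot /=; lra.
have [s1 s1F Hmax] := seq_argmax s0 F (fun s => (dot w s - dot w v) / sg s).
pose M := (dot w s1 - dot w v) / sg s1.
pose g := - (M * tau + (dot w t - dot w v)).
have g0 : 0 < g.
  have := Hw _ s1F; have := sg0 _ s1F => h1 h2.
  rewrite -(pmulr_rgt0 _ h1) /g /M.
  suff : sg s1 * - ((dot w s1 - dot w v) / sg s1 * tau + (dot w t - dot w v)) =
   - (tau * (dot w s1 - dot w v) + sg s1 * (dot w t - dot w v)) by lra.
  by field; rewrite gt_eqF.
(* Separating the old points requires [al > M]; separating [t] requires
   [al * tau < dot w v - dot w t]. As [tau] may be 0, the excess over [M] is divided by [tau + 1],
   which leaves the margin [g / (tau + 1)] at [t]. *)
pose al := M + g / (tau + 1).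
have t1 : 0 < tau + 1 by lra.
exists (w + (al * u.1, al * u.2)) => x.
have dotE y : dot (w + (al * u.1, al * u.2)) y = dot w y + al * dot u y.
  by rewrite /dot /=; ring.
rewrite !dotE inE => /orP[/eqP ->|xF].
  suff : al * tau + (dot w t - dot w v) < 0 by rewrite /tau; lra.
  have -> : al * tau + (dot w t - dot w v) = - (g / (tau + 1)).
    by rewrite /al /g; field; rewrite gt_eqF.
  by rewrite oppr_lt0 divr_gt0.
suff : dot w x - dot w v < al * sg x by rewrite /sg; lra.
rewrite -ltr_pdivrMr ?sg0//; apply: le_lt_trans (Hmax _ xF) _.
by rewrite /al ltrDl divr_gt0.
Qed.

End Hull.

(** * Convex position *)

Section Position.
Context {R : realType}.
Implicit Types (F C S : set (R * R)) (u v : R * R).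

Lemma hull_convex F :
  convex_set (convex_hull F : set (convex_lmodType (R * R)%type)).
Proof.
by apply: convP => a b t /andP[t0 t1] Fa Fb; apply: hull_comb => //; lra.
Qed.

Lemma vertex_setD_convex (Q : set (R * R)) v :
  convex_set (Q : set (convex_lmodType (R * R)%type)) -> vertex_set Q v ->
  convex_set (Q `\ v : set (convex_lmodType (R * R)%type)).
Proof.
move=> cQ [Qv ext] a b t; rewrite !inE => -[Qa av] [Qb bv]; split.
  by apply/set_mem; apply: cQ; rewrite inE.
move=> E.
have [t0|t0] := eqVneq t%:num 0.
  by apply: bv => /=; rewrite -[RHS]E /conv /= t0 /onem subr0 scale0r add0r scale1r.
have [t1|t1] := eqVneq t%:num 1.
  by apply: av => /=; rewrite -[RHS]E /conv /= t1 /onem subrr scale0r addr0 scale1r.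
have [] := ext a b t Qa Qb; last by move=> h _; exact: av.
- by rewrite lt_def t0 ge0.
- by rewrite lt_def eq_sym t1 le1.
- by rewrite E.
Qed.

Lemma vertex_notin_hull F v :
  vertex_set (convex_hull F) v -> ~ convex_hull (F `\ v) v.
Proof.
move=> Hv h; suff : (convex_hull F `\ v) v by case=> _; apply.
apply: hull_min h; first by apply: vertex_setD_convex => //; exact: hull_convex.
by move=> x [Fx xv]; split => //; exact: sub_hull.
Qed.

Lemma vertex_sub F v : vertex_set (convex_hull F) v -> F v.
Proof.
move=> Hv; apply: contrapT => nFv; apply: (vertex_notin_hull Hv).
by rewrite not_setD1//; case: Hv.
Qed.

Lemma separated_vertex S u v : S v ->
  (forall t, S t -> t = v \/ dot u t < dot u v) -> vertex_set (convex_hull S) v.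
Proof.
move=> Sv H; split; first exact: sub_hull.
have hS := hull_min (@below_convex R u v) H.
move=> a b t /hS /= Ha /hS /= Hb t0 t1 E.
have E1 : v.1 = t%:num * a.1 + (1 - t%:num) * b.1 by rewrite E.
have E2 : v.2 = t%:num * a.2 + (1 - t%:num) * b.2 by rewrite E.
have Eu : dot u v = t%:num * dot u a + (1 - t%:num) * dot u b.
  by rewrite /dot E1 E2; ring.
have t1' : 0 < 1 - t%:num by lra.
move: Eu; case: Ha Hb => [->|Ha] [->|Hb] // Eu; exfalso; [| |].
- have : 0 < (1 - t%:num) * (dot u v - dot u b) by rewrite mulr_gt0// subr_gt0.
  by lra.
- have : 0 < t%:num * (dot u v - dot u a) by rewrite mulr_gt0// subr_gt0.
  by lra.
- have : 0 < (1 - t%:num) * (dot u v - dot u b) by rewrite mulr_gt0// subr_gt0.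
  have : 0 < t%:num * (dot u v - dot u a) by rewrite mulr_gt0// subr_gt0.
  by lra.
Qed.

(** Generators lying in the hull of the others are discarded one at a time. By separation the
    remaining ones are all vertices, so a polygon is the hull of its vertices. *)
Lemma hull_reduced (F : seq (R * R)) : exists F0 : seq (R * R),
  convex_hull [set` F0] = convex_hull [set` F] /\
  forall v, v \in F0 -> ~ convex_hull ([set` F0] `\ v) v.
Proof.
have [n] := ubnP (size F); elim: n F => // n IH F sF.
have [H|/existsNP[v /not_implyP[vF /contrapT hv]]] :=
  pselect (forall v, v \in F -> ~ convex_hull ([set` F] `\ v) v).
  by exists F.
have E : [set` [seq x <- F | x != v]] = [set` F] `\ v.
  apply/seteqP; split => x /=; rewrite mem_filter.
    by move=> /andP[/eqP].
  by move=> [-> /eqP ->].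
have [|F0 [F0E HF0]] := IH [seq x <- F | x != v].
  rewrite ltnS in sF; apply: leq_trans sF.
  rewrite size_filter -(count_predC (pred1 v) F) -[ltnLHS]add0n ltn_add2r.
  by rewrite -has_count has_pred1.
exists F0; split => //; rewrite F0E E; apply/seteqP; split.
  by apply: hull_mono => x [].
move=> x hx C cC FC; apply: hx => // y Fy.
have [->|yv] := eqVneq y v; first exact: hv.
by apply: FC; split => //; exact/eqP.
Qed.

Lemma affine_near (a b c : R) (p : R * R) : 0 < a * p.1 + b * p.2 + c ->
  \forall q \near p, 0 < a * q.1 + b * q.2 + c.
Proof.
move=> H; have : (fun q : R * R => a * q.1 + b * q.2 + c) q @[q --> p] -->
    a * p.1 + b * p.2 + c.
  apply: cvgD; last exact: cvg_cst.
  apply: cvgD; apply: cvgM; first [exact: cvg_cst | exact: cvg_fst |exact: cvg_snd].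
by move=> /cvgr_gt; apply.
Qed.

(** Since both ends lie in [S], the hull has interior points exactly when some point of [S] is off
    the axis. What remains is that each point is strictly separated from the others. *)
Lemma in_convex_positionP S : finite_set S -> S (0, 0) -> S (1, 0) ->
  in_convex_position S <->
  (exists2 v, S v & v.2 != 0) /\
  forall v, S v -> exists u, forall t, S t -> t = v \/ dot u t < dot u v.
Proof.
move=> finS S0 S1; split.
  move=> [_ [Q [[F [finF QE]] [p pQ]] SE]].
  have [s sE] := (finite_seqP F).1 finF.
  split; last first.
    move=> v; rewrite {1}SE QE sE => Hv.
    have /separation [u Hu] : ~ convex_hull [set` [seq x <- s | x != v]] v.
      move=> h; apply: (vertex_notin_hull Hv); apply: hull_mono h => x /=.
      by rewrite mem_filter => /andP[/eqP xv xs].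
    exists u => t; rewrite SE QE sE => /vertex_sub /= ts.
    have [->|tv] := eqVneq t v; [by left|right].
    by apply: Hu; rewrite mem_filter tv.
  (* If every vertex lay on the axis, so would the generators left by [hull_reduced], hence all of
     [Q], which then could not contain a ball. *)
  apply: contrapT => H.
  have ax v : S v -> v.2 = 0.
    by move=> Sv; apply/eqP; apply: contrapT => /negP h; apply: H; exists v.
  have [F0 [F0E HF0]] := hull_reduced s.
  have F0S : [set` F0] `<=` S.
    move=> v /= vF0; rewrite SE QE sE -F0E.
    have /separation [u Hu] : ~ convex_hull [set` [seq x <- F0 | x != v]] v.
      move=> h; apply: (HF0 _ vF0); apply: hull_mono h => x /=.
      by rewrite mem_filter => /andP[/eqP xv xs].
    apply: (@separated_vertex _ u) => // t /= tF0.
    have [->|tv] := eqVneq t v; [by left|right].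
    by apply: Hu; rewrite mem_filter tv.
  have Qax : Q `<=` [set x | x.2 = 0].
    rewrite QE sE -F0E; apply: hull_min; last by move=> x /F0S/ax.
    by apply: convP => a b t _ /= -> ->; ring.
  move: pQ => /nbhs_ballP[e /= e0 He].
  have p0 : p.2 = 0 by apply: Qax; apply: He; exact: ballxx.
  have : ((p.1, p.2 + e / 2) : R * R).2 = 0.
    apply: Qax; apply: He; split => /=; first exact: ballxx.
    rewrite /ball /= opprD addrA subrr sub0r normrN ger0_norm; last by apply/ltW; lra.
    by lra.
  by rewrite /= p0; lra.
move=> [[v Sv v0] H]; split => //; exists (convex_hull S); last first.
  apply/seteqP; split => [x Sx|x /vertex_sub//].
  by have [u Hu] := H _ Sx; exact: separated_vertex Hu.
split; first by exists S.
have v0' : v.2 != 0 by [].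
(* The centroid of the triangle with vertices [(0, 0)], [(1, 0)] and [v]. The three affine functions
   below are the barycentric coordinates, each equal to 1/3 there, so they stay positive nearby. *)
exists ((1 + v.1) / 3, v.2 / 3); rewrite /interior /=.
have h1 := @affine_near 0 (v.2^-1) 0 ((1 + v.1) / 3, v.2 / 3).
have h2 := @affine_near 1 (- v.1 / v.2) 0 ((1 + v.1) / 3, v.2 / 3).
have h3 := @affine_near (-1) (v.1 / v.2 - v.2^-1) 1 ((1 + v.1) / 3, v.2 / 3).
have {}h1 : \forall q \near ((1 + v.1) / 3, v.2 / 3), 0 < 0 * q.1 + v.2^-1 * q.2 + 0.
  apply: h1 => /=.
  by rewrite (_ : _ + _ = 1 / 3); [lra|field].
have {}h2 : \forall q \near ((1 + v.1) / 3, v.2 / 3), 0 < 1 * q.1 + (- v.1 / v.2) * q.2 + 0.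
  apply: h2 => /=.
  by rewrite (_ : _ + _ = 1 / 3); [lra|field].
have {}h3 : \forall q \near ((1 + v.1) / 3, v.2 / 3), 0 < -1 * q.1 + (v.1 / v.2 - v.2^-1) * q.2 + 1.
  apply: h3 => /=.
  by rewrite (_ : _ + _ = 1 / 3); [lra|field].
near=> q.
have g0 : 0 < 0 * q.1 + v.2^-1 * q.2 + 0 by near: q.
have b0 : 0 < 1 * q.1 + (- v.1 / v.2) * q.2 + 0 by near: q.
have a0 : 0 < -1 * q.1 + (v.1 / v.2 - v.2^-1) * q.2 + 1 by near: q.
pose g := q.2 / v.2; pose b := q.1 - v.1 * g.
have gE : 0 < g by move: g0; rewrite /g; lra.
have bE : 0 < b by move: b0; rewrite /b /g; lra.
have aE : b + g < 1 by move: a0; rewrite /b /g; lra.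
have h : convex_hull S (b / (b + g) * 1 + g / (b + g) * v.1,
                        b / (b + g) * 0 + g / (b + g) * v.2).
  apply: (@hull_comb _ _ (1, 0) v); [exact: sub_hull|exact: sub_hull| | |].
  - by apply: divr_ge0; lra.
  - by apply: divr_ge0; lra.
  - by field; rewrite gt_eqF//; lra.
have {}h := @hull_comb _ _ (0, 0) _ (1 - (b + g)) (b + g) (sub_hull S0) h.
rewrite [q]surjective_pairing.
have <- : ((1 - (b + g)) * 0 + (b + g) * (b / (b + g) * 1 + g / (b + g) * v.1),
   (1 - (b + g)) * 0 + (b + g) * (b / (b + g) * 0 + g / (b + g) * v.2)) = (q.1, q.2).
  have bg : b + g != 0 by rewrite gt_eqF//; lra.
  congr pair.
    transitivity (b + g * v.1); first by field.
    by rewrite /b; ring.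
  transitivity (g * v.2); first by field.
  by rewrite /g; field.
by apply: h; lra.
Unshelve. all: by end_near.
Qed.

(** Finitely many strict inequalities survive a small perturbation of [u]. Rational functionals turn
    the existence of a separating one into a countable union. *)
Lemma rational_near (D : seq (R * R)) u : (forall x, x \in D -> dot u x < 0) ->
  exists r : rat * rat, forall x, x \in D -> dot (ratr r.1, ratr r.2) x < 0.
Proof.
move=> H.
have [e e0 He] : exists2 e : R, 0 < e & forall u' : R * R,
    `|u'.1 - u.1| < e -> `|u'.2 - u.2| < e -> forall x, x \in D -> dot u' x < 0.
  elim: D H => [|x D IH] H; first by exists 1.
  have [|e e0 He] := IH; first by move=> y yD; apply: H; rewrite inE yD orbT.
  have Hx : dot u x < 0 by apply: H; exact: mem_head.
  have n1 := normr_ge0 x.1; have n2 := normr_ge0 x.2.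
  have m0 : 0 < `|x.1| + `|x.2| + 1 by lra.
  (* Moving both coordinates of [u] by less than a radius changes [dot u x] by at most that radius
     times the sum of the [|x.i|]; the added 1 keeps the denominator positive when [x] is 0. *)
  exists (Num.min e (- dot u x / (`|x.1| + `|x.2| + 1))).
    by rewrite lt_min e0 divr_gt0// oppr_gt0.
  move=> u'; rewrite !lt_min => /andP[a1 b1] /andP[a2 b2] y.
  rewrite inE => /orP[/eqP ->|]; last exact: He.
  rewrite ltr_pdivlMr// in b1; rewrite ltr_pdivlMr// in b2.
  have -> : dot u' x = dot u x + ((u'.1 - u.1) * x.1 + (u'.2 - u.2) * x.2).
    by rewrite /dot; ring.
  have c1 : (u'.1 - u.1) * x.1 <= `|u'.1 - u.1| * `|x.1|.
    by rewrite -normrM ler_norm.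
  have c2 : (u'.2 - u.2) * x.2 <= `|u'.2 - u.2| * `|x.2|.
    by rewrite -normrM ler_norm.
  have k1 := normr_ge0 (u'.1 - u.1); have k2 := normr_ge0 (u'.2 - u.2).
  move: b1 b2 c1 c2 k1 k2.
  move: (`|u'.1 - u.1|) (`|u'.2 - u.2|) ((u'.1 - u.1) * x.1) ((u'.2 - u.2) * x.2).
  move=> k1 k2 d1 d2 b1 b2 c1 c2 k10 k20.
  have [kk|kk] := leP k1 k2.
    have : k1 * `|x.1| <= k2 * `|x.1| by rewrite ler_wpM2r.
    by lra.
  have : k2 * `|x.2| <= k1 * `|x.2| by rewrite ler_wpM2r// ltW.
  by lra.
have [r1] := @rat_in_itvoo R (u.1 - e) (u.1 + e) ltac:(lra).
rewrite in_itv /= => /andP[h1 h2].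
have [r2] := @rat_in_itvoo R (u.2 - e) (u.2 + e) ltac:(lra).
rewrite in_itv /= => /andP[h3 h4].
by exists (r1, r2); apply: He => /=; rewrite ltr_norml; apply/andP; split; lra.
Qed.

End Position.

(** * Splitting a concave chain at its highest point *)

Definition in_cap {R : realType} (z : R * R) : bool :=
  [&& 0 < z.1, z.1 < 1, 0 < z.2 & z.2 < G z.1].

(** For increasing abscissas: the slope from [b] to [c] is less than the slope from [a] to [b], with
    denominators cleared. *)
Definition concave3 {R : realType} (a b c : R * R) : bool :=
  (c.2 - b.2) * (b.1 - a.1) < (b.2 - a.2) * (c.1 - b.1).

(** Imposed on all triples, not only on consecutive ones, so that the points need not be sorted.
    Points with equal abscissas are not compared with each other. *)
Definition concave_chain {R : realType} (S : set (R * R)) : Prop :=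
  forall a b c, S a -> S b -> S c -> a.1 < b.1 -> b.1 < c.1 -> concave3 a b c.

Definition cap_chain {R : realType} {I : finType} (A : {set I})
    (z : I -> R * R) : Prop :=
  (forall j, j \in A -> in_cap (z j)) /\
  concave_chain (z @` [set` A] `|` [set (0, 0); (1, 0)]).

(* The affine map sending the region between the parabola l * G and its chord
   over [a, b] onto the region D. *)
Definition rescale {R : realType} (l a b : R) (z : R * R) : R * R :=
  ((z.1 - a) / (b - a),
   (z.2 - 6 * l * ((1 - a - b) * z.1 + a * b)) / (l * (b - a) ^+ 2)).

Definition height {R : realType} (z : R * R) : R := z.2 / G z.1.

Definition rescaleL {R : realType} (w : R * R) := rescale (height w) 0 w.1.
Definition rescaleR {R : realType} (w : R * R) := rescale (height w) w.1 1.

(* The chain through z @` A is split at its highest point z i, the other points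
   being those indexed by L on its left and the rest on its right. *)
Definition split_chain {R : realType} {I : finType} (A : {set I}) (i : I)
    (L : {set I}) (z : I -> R * R) : Prop :=
  [/\ in_cap (z i), cap_chain L (rescaleL (z i) \o z) &
      cap_chain ((A :\ i) :\: L) (rescaleR (z i) \o z)].

(** The two coincidences that spoil the splitting: equal abscissas, invisible to [concave_chain],
    and equal heights, which make the highest point ambiguous. *)
Definition tie {R : realType} (p q : R * R) : bool :=
  (p.1 == q.1) || (p.2 * G q.1 == q.2 * G p.1).

Section Chain.
Context {R : realType}.
Implicit Types (a b c w z : R * R) (l : R).

Lemma G_gt0 (x : R) : 0 < x -> x < 1 -> 0 < G x.
Proof. by move=> x0 x1; rewrite /G !mulr_gt0// subr_gt0. Qed.

Lemma heightK w : in_cap w -> height w * G w.1 = w.2.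
Proof. by move=> /and4P[w0 w1 _ _]; rewrite divfK// gt_eqF// G_gt0. Qed.

Lemma height_gt0 w : in_cap w -> 0 < height w.
Proof. by move=> /and4P[w0 w1 w2 _]; rewrite divr_gt0// G_gt0. Qed.

Lemma height_lt1 w : in_cap w -> height w < 1.
Proof.
by move=> /and4P[w0 w1 w2 wG]; rewrite ltr_pdivrMr ?mul1r// G_gt0.
Qed.

(** The lower bound for [z.2] is the chord of [l * G] over [[a, b]]. The parabola minus this chord
    is [6 * l * (x - a) * (b - x)], which rescales to [G]. *)
Lemma in_cap_rescale l (a b : R) z : 0 < l -> a < b ->
  in_cap (rescale l a b z) =
  [&& a < z.1, z.1 < b, 6 * l * ((1 - a - b) * z.1 + a * b) < z.2
    & z.2 < l * G z.1].
Proof.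
move=> l0 ab; have ba : 0 < b - a by rewrite subr_gt0.
have lb : 0 < l * (b - a) ^+ 2 by rewrite mulr_gt0// exprn_gt0.
rewrite /in_cap /=; congr [&& _, _, _ & _].
- by rewrite pmulr_lgt0 ?invr_gt0// subr_gt0.
- by rewrite ltr_pdivrMr// mul1r ltrD2r.
- by rewrite pmulr_lgt0 ?invr_gt0// subr_gt0.
- rewrite ltr_pdivrMr// -subr_gt0 -[RHS]subr_gt0; congr (0 < _).
  by rewrite /G; field; rewrite gt_eqF.
Qed.

(** [concave3] is the sign of a determinant, which this affine map divides by its positive area
    factor [l * (b - a) ^+ 3]. *)
Lemma concave3_rescale l (a b : R) p q r : 0 < l -> a < b ->
  concave3 (rescale l a b p) (rescale l a b q) (rescale l a b r) = concave3 p q r.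
Proof.
move=> l0 ab; have ba : 0 < b - a by rewrite subr_gt0.
have lb : 0 < (l * (b - a) ^+ 3)^-1 by rewrite invr_gt0 mulr_gt0// exprn_gt0.
rewrite /concave3 -subr_gt0 -[RHS]subr_gt0 -[RHS](pmulr_rgt0 _ lb) /rescale /=.
by congr (0 < _); field; rewrite !gt_eqF.
Qed.

Lemma rescale_end1 l (a b : R) : a < b -> 0 < l -> rescale l a b (a, l * G a) = (0, 0).
Proof.
move=> ab l0; have ba : 0 < b - a by rewrite subr_gt0.
by rewrite /rescale /G /=; congr pair; field; rewrite ?gt_eqF.
Qed.

Lemma rescale_end2 l (a b : R) : a < b -> 0 < l -> rescale l a b (b, l * G b) = (1, 0).
Proof.
move=> ab l0; have ba : 0 < b - a by rewrite subr_gt0.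
by rewrite /rescale /G /=; congr pair; field; rewrite ?gt_eqF.
Qed.

Lemma concave_chain_sub (S T : set (R * R)) : S `<=` T -> concave_chain T ->
  concave_chain S.
Proof. by move=> ST H a b c /ST Sa /ST Sb /ST; exact: H. Qed.

Lemma concave_chain_rescale l (a b : R) (S : set (R * R)) : 0 < l -> a < b ->
  concave_chain (rescale l a b @` S) <-> concave_chain S.
Proof.
move=> l0 ab; have ba : 0 < b - a by rewrite subr_gt0.
have mono p q : ((rescale l a b p).1 < (rescale l a b q).1) = (p.1 < q.1).
  by rewrite /rescale /= ltr_pM2r ?invr_gt0// ltrD2r.
split=> H.
  move=> p q r Sp Sq Sr pq qr; rewrite -(concave3_rescale _ _ _ l0 ab).
  by apply: H; rewrite ?mono.
move=> _ _ _ [p Sp <-] [q Sq <-] [r Sr <-]; rewrite !mono => pq qr.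
by rewrite concave3_rescale//; exact: H.
Qed.

Lemma cap_chain_rescale (I : finType) (A : {set I}) (z : I -> R * R) l (a b : R) :
  0 < l -> a < b ->
  cap_chain A (rescale l a b \o z) <->
  (forall j, j \in A -> [&& a < (z j).1, (z j).1 < b,
      6 * l * ((1 - a - b) * (z j).1 + a * b) < (z j).2
      & (z j).2 < l * G (z j).1]) /\
  concave_chain (z @` [set` A] `|` [set (a, l * G a); (b, l * G b)]).
Proof.
move=> l0 ab; have := concave_chain_rescale (z @` [set` A] `|` [set (a, l * G a); (b, l * G b)])
  l0 ab; rewrite /cap_chain.
rewrite image_setU image_setU !image_set1 rescale_end1// rescale_end2//.
rewrite -image_comp.
move=> E; split=> -[H1 H2]; (split; last exact/E);
  by move=> j /H1; rewrite /= in_cap_rescale.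
Qed.

(** Writing [[abc]] for the determinant compared in [concave3], [(w.1 - b.1) [abc] = (c.1 - b.1)
    [abw] + (b.1 - a.1) [bwc]]. With its mirror image below, it handles triples that straddle the
    split point [w]. *)
Lemma concave3_transl a b w c : a.1 < b.1 -> b.1 < w.1 -> w.1 < c.1 ->
  concave3 a b w -> concave3 b w c -> concave3 a b c.
Proof.
rewrite /concave3 => ab bw wc H1 H2.
have bw' : 0 < w.1 - b.1 by lra.
have ab' : 0 < b.1 - a.1 by lra.
have bc' : 0 < c.1 - b.1 by lra.
rewrite -subr_gt0 in H1; rewrite -subr_gt0 in H2; rewrite -subr_gt0.
rewrite -(pmulr_rgt0 _ bw').
have K1 := mulr_gt0 bc' H1; have K2 := mulr_gt0 ab' H2.
have := addr_gt0 K1 K2; congr (0 < _); ring.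
Qed.

Lemma concave3_transr a w b c : a.1 < w.1 -> w.1 < b.1 -> b.1 < c.1 ->
  concave3 a w b -> concave3 w b c -> concave3 a b c.
Proof.
rewrite /concave3 => aw wb bc H1 H2.
have wb' : 0 < b.1 - w.1 by lra.
have ab' : 0 < b.1 - a.1 by lra.
have bc' : 0 < c.1 - b.1 by lra.
rewrite -subr_gt0 in H1; rewrite -subr_gt0 in H2; rewrite -subr_gt0.
rewrite -(pmulr_rgt0 _ wb').
have K1 := mulr_gt0 bc' H1; have K2 := mulr_gt0 ab' H2.
have := addr_gt0 K1 K2; congr (0 < _); ring.
Qed.

(** Raising [a] and [c] to the parabola only makes the inequality harder. For three points on it,
    the difference of the two sides is [6 * l * (w.1 - a.1) * (c.1 - w.1) * (c.1 - a.1)]. *)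
Lemma concave3_parabola l a w c : 0 < l -> a.1 < w.1 -> w.1 < c.1 ->
  a.2 <= l * G a.1 -> w.2 = l * G w.1 -> c.2 <= l * G c.1 -> concave3 a w c.
Proof.
move=> l0 aw wc Ha Hw Hc; rewrite /concave3.
have aw' : 0 < w.1 - a.1 by lra.
have wc' : 0 < c.1 - w.1 by lra.
have ac' : 0 < c.1 - a.1 by lra.
apply: (@le_lt_trans _ _ ((l * G c.1 - w.2) * (w.1 - a.1))).
  by rewrite ler_pM2r// lerD2r.
apply: (@lt_le_trans _ _ ((w.2 - l * G a.1) * (c.1 - w.1))); last first.
  by rewrite ler_pM2r// lerD2l lerN2.
rewrite Hw -subr_gt0.
have := mulr_gt0 (mulr_gt0 (mulr_gt0 l0 aw') wc') ac'.
rewrite /G; lra.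
Qed.

Section Split.
Context {I : finType}.
Implicit Types A L : {set I}.

(** Both rescalings are undone, so that the two sides share one coordinate system. The linear lower
    bounds are the chords from the ends to [z i], because [height (z i) * G (z i).1 = (z i).2]. *)
Lemma split_chainP A i L (z : I -> R * R) : i \in A -> L \subset A :\ i ->
  split_chain A i L z <->
  [/\ in_cap (z i),
      forall j, j \in L -> [&& 0 < (z j).1, (z j).1 < (z i).1,
        6 * height (z i) * (1 - (z i).1) * (z j).1 < (z j).2
        & (z j).2 < height (z i) * G (z j).1],
      concave_chain (z @` [set` L] `|` [set (0, 0); z i]),
      forall j, j \in (A :\ i) :\: L -> [&& (z i).1 < (z j).1, (z j).1 < 1,
        6 * height (z i) * (z i).1 * (1 - (z j).1) < (z j).2
        & (z j).2 < height (z i) * G (z j).1] &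
      concave_chain (z @` [set` (A :\ i) :\: L] `|` [set z i; (1, 0)])].
Proof.
move=> iA LA; rewrite /split_chain.
have [ci|nci] := boolP (in_cap (z i)); last by split=> -[].
have /and4P[x0 x1 y0 yG] := ci.
have l0 := height_gt0 ci.
have e0 : ((0 : R), height (z i) * G 0) = (0, 0) by congr pair; rewrite /G; ring.
have e1 : ((1 : R), height (z i) * G 1) = (1, 0) by congr pair; rewrite /G; ring.
have EL := cap_chain_rescale L z l0 x0.
have ER := cap_chain_rescale ((A :\ i) :\: L) z l0 x1.
rewrite e0 heightK// -surjective_pairing in EL.
rewrite e1 heightK// -surjective_pairing in ER.
have E1 j : 6 * height (z i) * ((1 - 0 - (z i).1) * (z j).1 + 0 * (z i).1) =
  6 * height (z i) * (1 - (z i).1) * (z j).1 by ring.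
have E2 j : 6 * height (z i) * ((1 - (z i).1 - 1) * (z j).1 + (z i).1 * 1) =
  6 * height (z i) * (z i).1 * (1 - (z j).1) by ring.
split.
  move=> [_ /EL[H1 H2] /ER[H3 H4]].
  by split => // j jL; [rewrite -E1; exact: H1|rewrite -E2; exact: H3].
move=> [_ H1 H2 H3 H4]; split => //.
  by apply/EL; split => // j jL; rewrite E1; exact: H1.
by apply/ER; split => // j jL; rewrite E2; exact: H3.
Qed.

(** Triples on one side of [z i] are concave by hypothesis, and those with [z i] in the middle by
    [concave3_parabola]. Any other triple straddles [z i] and is composed from one of each kind. *)
Lemma split_chain_cap A i L (z : I -> R * R) : i \in A -> L \subset A :\ i ->
  split_chain A i L z -> cap_chain A z.
Proof.
move=> iA LA /(split_chainP _ iA LA) [ci HL CL HR CR].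
have /and4P[x0 x1 y0 yG] := ci.
have l0 := height_gt0 ci; have l1 := height_lt1 ci.
have capA j : j \in A -> in_cap (z j) /\
    (z j = z i \/ (j \in L /\ (z j).1 < (z i).1) \/
     (j \in (A :\ i) :\: L /\ (z i).1 < (z j).1)).
  move=> jA; have [->|ji] := eqVneq j i; first by split => //; left.
  have lG : 0 < (z j).1 -> (z j).1 < 1 -> height (z i) * G (z j).1 <= G (z j).1.
    by move=> j0 j1; rewrite ger_pMl ?G_gt0// ltW.
  have [jL|jL] := boolP (j \in L).
    have /and4P[h1 h2 h3 h4] := HL _ jL.
    have h5 : (z j).1 < 1 by lra.
    split; last by right; left.
    apply/and4P; split => //.
      by apply: lt_trans h3; apply: mulr_gt0 => //; apply: mulr_gt0; [apply: mulr_gt0|lra].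
    by apply: lt_le_trans h4 _; exact: lG.
  have jR : j \in (A :\ i) :\: L by rewrite !inE jL ji jA.
  have /and4P[h1 h2 h3 h4] := HR _ jR.
  have h5 : 0 < (z j).1 by lra.
  split; last by right; right.
  apply/and4P; split => //.
    by apply: lt_trans h3; apply: mulr_gt0; [do 2!apply: mulr_gt0 => //|lra].
  by apply: lt_le_trans h4 _; exact: lG.
split; first by move=> j /capA[].
pose S := z @` [set` A] `|` [set (0, 0); (1, 0)].
have under p : S p -> p.2 <= height (z i) * G p.1.
  move=> [[j /= jA <-]|[->|->]]; last 2 first.
  - by rewrite /G /=; lra.
  - by rewrite /G /=; lra.
  have [_ [->|[[jL _]|[jR _]]]] := capA _ jA; first by rewrite heightK.
    by have /and4P[_ _ _ /ltW] := HL _ jL.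
  by have /and4P[_ _ _ /ltW] := HR _ jR.
have left p : S p -> p.1 < (z i).1 -> (z @` [set` L] `|` [set (0, 0); z i]) p.
  move=> [[j /= jA <-]|[->|->]] /= h; last 2 first.
  - by right; left.
  - by exfalso; lra.
  have [_ [E|[[jL _]|[jR h']]]] := capA _ jA; last by exfalso; lra.
    by right; right.
  by left; exists j.
have right p : S p -> (z i).1 < p.1 ->
    (z @` [set` (A :\ i) :\: L] `|` [set z i; (1, 0)]) p.
  move=> [[j /= jA <-]|[->|->]] /= h; last 2 first.
  - by exfalso; lra.
  - by right; right.
  have [_ [E|[[jL h']|[jR _]]]] := capA _ jA; last by left; exists j.
    by right; left.
  by exfalso; lra.
have mid p : S p -> p.1 = (z i).1 -> p = z i.
  move=> [[j /= jA <-]|[->|->]] /= h; last 2 first.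
  - by exfalso; lra.
  - by exfalso; lra.
  by have [_ [//|[[_ h']|[_ h']]]] := capA _ jA; exfalso; lra.
have Sl : (z @` [set` L] `|` [set (0, 0); z i]) (z i) by right; right.
have Sr : (z @` [set` (A :\ i) :\: L] `|` [set z i; (1, 0)]) (z i) by right; left.
have cross p q : S p -> S q -> p.1 < (z i).1 -> (z i).1 < q.1 ->
    concave3 p (z i) q.
  move=> Sp Sq pi iq; apply: (concave3_parabola l0) => //; [exact: under| |exact: under].
  by rewrite heightK.
move=> p q r Sp Sq Sr' pq qr.
have [qi|iq|qi] := ltrgtP q.1 (z i).1.
- have [ri|ir|ri] := ltrgtP r.1 (z i).1.
  + by apply: CL => //; apply: left => //; lra.
  + apply: (concave3_transl pq qi ir); last by exact: cross.
    by apply: CL => //; apply: left => //; lra.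
  + rewrite (mid r)//.
    by apply: CL => //; apply: left => //; lra.
- have [pi|ip|pi] := ltrgtP p.1 (z i).1.
  + apply: (concave3_transr pi iq qr); first by exact: cross.
    by apply: CR => //; apply: right => //; lra.
  + by apply: CR => //; apply: right => //; lra.
  + rewrite (mid p)//.
    by apply: CR => //; apply: right => //; lra.
- rewrite (mid q)//; apply: cross => //; lra.
Qed.

(** Ties are excluded for two reasons: equal heights would put another point on the parabola through
    the highest one, and equal abscissas would leave a point on neither side. The chord bounds come
    from the triples formed by [z j], [z i] and one end. *)
Lemma cap_chain_split A (z : I -> R * R) : A != finset.set0 -> cap_chain A z ->
  (forall j k, j \in A -> k \in A -> j != k -> ~~ tie (z j) (z k)) ->
  exists i L, [/\ i \in A, L \subset A :\ i & split_chain A i L z].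
Proof.
move=> A0 [capA CA] noties.
have [i iA Hi] : exists2 i, i \in A & forall j, j \in A -> height (z j) <= height (z i).
  have [k kA] := finset.set0Pn _ A0.
  have : enum A != [::] by apply: contraTneq kA => E; rewrite -mem_enum E.
  case E : (enum A) => [//|s0 s] _.
  have [i ii Hi] := seq_argmax s0 s (fun j => height (z j)).
  by exists i => [|j]; rewrite -mem_enum E //; exact: Hi.
have ci := capA _ iA; have /and4P[x0 x1 y0 yG] := ci.
have l0 := height_gt0 ci.
have below j : j \in A -> j != i -> (z j).2 < height (z i) * G (z j).1.
  move=> jA ji; have cj := capA _ jA; have /and4P[a0 a1 _ _] := cj.
  rewrite -(heightK cj) ltr_pM2r ?G_gt0// lt_def Hi// andbT.
  apply/negP => /eqP E; have := noties _ _ jA iA ji.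
  rewrite /tie -(heightK cj) -(heightK ci) E mulrAC eqxx orbT//.
have wE := heightK ci.
exists i, [set j in A :\ i | (z j).1 < (z i).1]; split => //.
  by apply/fintype.subsetP => j; rewrite inE => /andP[].
apply/split_chainP => //; first by apply/fintype.subsetP => j; rewrite inE => /andP[].
pose S := z @` [set` A] `|` [set (0, 0); (1, 0)].
have Sz j : j \in A -> S (z j) by move=> jA; left; exists j.
have S0 : S (0, 0) by right; left.
have S1 : S (1, 0) by right; right.
split => //.
- move=> j; rewrite !inE => /andP[/andP[ji jA] h].
  have /and4P[a0 a1 b0 _] := capA _ jA.
  rewrite a0 h below// andbT /=.
  have := CA _ _ _ S0 (Sz _ jA) (Sz _ iA) a0 h; rewrite /concave3 /= => K.
  rewrite -(ltr_pM2r x0).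
  have -> : 6 * height (z i) * (1 - (z i).1) * (z j).1 * (z i).1 =
    (height (z i) * G (z i).1) * (z j).1 by rewrite /G; ring.
  by rewrite wE; lra.
- apply: concave_chain_sub CA => p [[j /=]|].
    by rewrite !inE => /andP[/andP[_ jA] _] <-; exact: Sz.
  by move=> [|] -> //; exact: Sz.
- move=> j; rewrite !inE => /andP[+ /andP[ji jA]]; rewrite ji jA /= -leNgt => h'.
  have h : (z i).1 < (z j).1.
    rewrite lt_def h' andbT; apply/negP => /eqP E.
    by have := noties _ _ jA iA ji; rewrite /tie E eqxx.
  have /and4P[a0 a1 b0 _] := capA _ jA.
  rewrite a1 h below// andbT /=.
  have := CA _ _ _ (Sz _ iA) (Sz _ jA) S1 h a1; rewrite /concave3 /= => K.
  have x1' : 0 < 1 - (z i).1 by lra.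
  rewrite -(ltr_pM2r x1').
  have -> : 6 * height (z i) * (z i).1 * (1 - (z j).1) * (1 - (z i).1) =
    (height (z i) * G (z i).1) * (1 - (z j).1) by rewrite /G; ring.
  by rewrite wE; lra.
- apply: concave_chain_sub CA => p [[j /=]|].
    by rewrite !inE => /andP[_ /andP[_ jA]] <-; exact: Sz.
  by move=> [|] -> //; exact: Sz.
Qed.

(** In a split chain [z i] is strictly higher than all other points, which determines [i]; then the
    abscissas determine [L]. Hence the split events are disjoint and their probabilities add up. *)
Lemma split_chain_inj A i L i' L' (z : I -> R * R) : i \in A -> L \subset A :\ i ->
  i' \in A -> L' \subset A :\ i' ->
  split_chain A i L z -> split_chain A i' L' z -> i = i' /\ L = L'.
Proof.
have lower k (K : {set I}) : k \in A -> K \subset A :\ k -> split_chain A k K z ->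
    forall j, j \in A -> j != k -> height (z j) < height (z k).
  move=> kA KA H j jA jk.
  have /and4P[a0 a1 _ _] := (split_chain_cap kA KA H).1 _ jA.
  have /(split_chainP _ kA KA) [ck HL _ HR _] := H.
  rewrite {1}/height ltr_pdivrMr ?G_gt0//.
  have [jK|jK] := boolP (j \in K); first by have /and4P[] := HL _ jK.
  by have /HR/and4P[] : j \in (A :\ k) :\: K by rewrite !inE jK jk jA.
move=> iA LA iA' LA' H H'.
have ii' : i = i'.
  apply/eqP; apply/negPn/negP => ne.
  have h1 := lower _ _ iA LA H _ iA'; have h2 := lower _ _ iA' LA' H' _ iA ne.
  by have := lt_trans h2 (h1 _); rewrite ltxx eq_sym ne => /(_ isT).
split => //; subst i'.
have LE (K : {set I}) : K \subset A :\ i -> split_chain A i K z ->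
    forall j, (j \in K) = (j \in A :\ i) && ((z j).1 < (z i).1).
  move=> KA /(split_chainP _ iA KA)[_ HL _ HR _] j.
  have [jK|jK] := boolP (j \in K).
    by rewrite (fintype.subsetP KA _ jK); have /and4P[_ -> ] := HL _ jK.
  have [jA|//] := boolP (j \in A :\ i).
  have /HR/and4P[h _ _ _] : j \in (A :\ i) :\: K by rewrite finset.in_setD jK jA.
  by rewrite ltNge (ltW h).
by apply/setP => j; rewrite (LE _ LA H) (LE _ LA' H').
Qed.

End Split.
End Chain.

(** * Joint laws *)

Section MeasurablePredicates.
Context d (T : measurableType d).

Lemma measurable_bool (f : T -> bool) : measurable_fun setT f ->
  measurable [set x | f x].
Proof.
move=> mf; rewrite -[X in measurable X]setTI.
exact: mf measurableT [set true] _.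
Qed.

Lemma measurable_forall (K : finType) (P : K -> T -> Prop) :
  (forall k, measurable [set x | P k x]) -> measurable [set x | forall k, P k x].
Proof.
move=> mP; rewrite (_ : [set x | _] = \bigcap_(k in [set: K]) [set x | P k x]).
  by apply: fin_bigcap_measurable => //; exact: finite_finset.
by apply/seteqP; split=> x /= H => [k _|k]; exact: H.
Qed.

Lemma measurable_exists (K : countType) (P : K -> T -> Prop) :
  (forall k, measurable [set x | P k x]) ->
  measurable [set x | exists k, P k x].
Proof.
move=> mP; rewrite (_ : [set x | _] = \bigcup_k [set x | P k x]).
  exact: countable_bigcupT_measurable.
by apply/seteqP; split=> x /= => [[k Hk]|[k _ Hk]]; exists k.
Qed.

Lemma measurable_imply (b : Prop) (P : T -> Prop) :
  (b -> measurable [set x | P x]) -> measurable [set x | b -> P x].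
Proof.
move=> mP; have [hb|hb] := pselect b.
  rewrite (_ : [set x | _] = [set x | P x]); first exact: mP.
  by apply/seteqP; split=> x /= h; [exact: h|].
rewrite (_ : [set x | _] = setT); first exact: measurableT.
by apply/seteqP; split=> x //= _ /hb.
Qed.

Lemma measurable_pred_imply (Q P : T -> Prop) :
  measurable [set x | Q x] -> measurable [set x | P x] ->
  measurable [set x | Q x -> P x].
Proof.
move=> mQ mP; rewrite (_ : [set x | _] = ~` [set x | Q x] `|` [set x | P x]).
  by apply: measurableU => //; exact: measurableC.
apply/seteqP; split=> x /= h.
  by have [q|q] := pselect (Q x); [right; exact: h|left].
by case: h.
Qed.

Lemma measurable_pred_and (Q P : T -> Prop) :
  measurable [set x | Q x] -> measurable [set x | P x] ->
  measurable [set x | Q x /\ P x].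
Proof. exact: measurableI. Qed.

Lemma measurable_pred_or (Q P : T -> Prop) :
  measurable [set x | Q x] -> measurable [set x | P x] ->
  measurable [set x | Q x \/ P x].
Proof. exact: measurableU. Qed.

End MeasurablePredicates.

Section LawUniqueness.
Context {R : realType} {I : finType} {d : measure_display} {T : measurableType d}.
Implicit Types (A : {set I}).

(** The pi-system generating the product sigma-algebra in the coordinates of [A]; the other
    coordinates are left free. *)
Definition boxes A : set (set (I -> T)) :=
  [set C | exists2 B : I -> set T, (forall j, measurable (B j)) &
     C = [set z | forall j, j \in A -> B j (z j)]].

Lemma boxes_setI_closed A : setI_closed (boxes A).
Proof.
move=> _ _ [B mB ->] [B' mB' ->]; exists (fun j => B j `&` B' j).
  by move=> j; exact: measurableI.
apply/seteqP; split=> z /= => [[H H'] j jA|H]; first by split; [exact: H|exact: H'].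
by split=> j /H[].
Qed.

Lemma measurable_to_boxes A d' (Omega : measurableType d') (X : I -> Omega -> T) :
  (forall j, j \in A -> measurable_fun setT (X j)) ->
  measurable_fun setT
    ((fun w => X^~ w) : Omega -> g_sigma_algebraType (boxes A)).
Proof.
move=> mX; apply: (@measurability _ _ Omega (g_sigma_algebraType (boxes A)) setT
  (fun w => X^~ w) (boxes A) erefl).
move=> _ [_ [B mB ->] <-]; rewrite setTI.
apply: (@measurable_forall _ _ I (fun j w => j \in A -> B j (X j w))) => j.
apply: measurable_imply => jA.
by rewrite -[X in measurable X]setTI; exact: mX.
Qed.

Lemma measurable_from_boxes A j : j \in A ->
  measurable_fun setT ((fun z => z j) : g_sigma_algebraType (boxes A) -> T).
Proof.
move=> jA _ B mB; rewrite setTI; apply: sub_sigma_algebra.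
exists (fun k => if k == j then B else setT).
  by move=> k; case: ifP => // _.
apply/seteqP; split=> z /= => [Bz k kA|H]; first by case: eqP => // ->.
by have := H _ jA; rewrite eqxx.
Qed.

(** The pi-lambda theorem, transferring events between sample spaces. It is stated for finite
    measures because restricted and scaled probabilities are compared as well. *)
Lemma law_unique A d1 d2 (W1 : measurableType d1) (W2 : measurableType d2)
    (m1 : {measure set W1 -> \bar R}) (m2 : {measure set W2 -> \bar R})
    (X1 : I -> W1 -> T) (X2 : I -> W2 -> T) :
  (forall j, j \in A -> measurable_fun setT (X1 j)) ->
  (forall j, j \in A -> measurable_fun setT (X2 j)) ->
  (m1 setT < +oo)%E ->
  (forall B : I -> set T, (forall j, measurable (B j)) ->
     m1 [set w | forall j, j \in A -> B j (X1 j w)] =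
     m2 [set w | forall j, j \in A -> B j (X2 j w)]) ->
  forall E : set (I -> T),
    (@measurable _ (g_sigma_algebraType (boxes A)) E) ->
    m1 [set w | E (X1^~ w)] = m2 [set w | E (X2^~ w)].
Proof.
move=> mX1 mX2 m1oo m12 E mE.
have mf1 := measurable_to_boxes mX1; have mf2 := measurable_to_boxes mX2.
have pre1 C : (@measurable _ (g_sigma_algebraType (boxes A)) C) ->
    measurable [set w | C (X1^~ w)].
  by move=> mC; rewrite -[X in measurable X]setTI; exact: (mf1 measurableT C mC).
have pre2 C : (@measurable _ (g_sigma_algebraType (boxes A)) C) ->
    measurable [set w | C (X2^~ w)].
  by move=> mC; rewrite -[X in measurable X]setTI; exact: (mf2 measurableT C mC).
pose H := [set C : set (I -> T) |
  [/\ (@measurable _ (g_sigma_algebraType (boxes A)) C) &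
   m1 [set w | C (X1^~ w)] = m2 [set w | C (X2^~ w)]]].
have m12T : m1 setT = m2 setT.
  have := m12 (fun=> setT) (fun=> measurableT).
  have -> : [set w | forall j, j \in A -> [set: T] (X1 j w)] = setT.
    by apply/seteqP; split.
  have -> // : [set w | forall j, j \in A -> [set: T] (X2 j w)] = setT.
  by apply/seteqP; split.
have m1oo' C : measurable C -> (m1 C < +oo)%E.
  by move=> mC; apply: le_lt_trans m1oo; apply: le_measure; rewrite ?inE.
have m2oo' C : measurable C -> (m2 C < +oo)%E.
  by move=> mC; rewrite (le_lt_trans _ m1oo)// m12T; apply: le_measure; rewrite ?inE.
suff : <<s boxes A>> `<=` H by move=> /(_ _ mE)[].
apply: lambda_system_subset => //.
- exact: boxes_setI_closed.
- split => //.
  + move=> C C' C'C [mC EC] [mC' EC']; split.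
      exact: measurableD.
    have e1 : [set w | (C `\` C') (X1^~ w)] =
      [set w | C (X1^~ w)] `\` [set w | C' (X1^~ w)] by [].
    have e2 : [set w | (C `\` C') (X2^~ w)] =
      [set w | C (X2^~ w)] `\` [set w | C' (X2^~ w)] by [].
    rewrite e1 e2 !measureD; [|exact: pre2|exact: pre2|exact/m2oo'/pre2
      |exact: pre1|exact: pre1|exact/m1oo'/pre1].
    rewrite !setIidr; [|by move=> w; exact: C'C|by move=> w; exact: C'C].
    by congr (_ - _)%E; [exact: EC|exact: EC'].
  + move=> F ndF HF; split.
      by apply: bigcupT_measurable => k;
        have [] := HF k.
    have e1 : [set w | (\bigcup_i F i) (X1^~ w)] =
      \bigcup_i [set w | F i (X1^~ w)] by [].
    have e2 : [set w | (\bigcup_i F i) (X2^~ w)] =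
      \bigcup_i [set w | F i (X2^~ w)] by [].
    have c1 : m1 [set w | F n (X1^~ w)] @[n --> \oo] -->
        m1 (\bigcup_i [set w | F i (X1^~ w)]).
      apply: nondecreasing_cvg_mu.
      * by move=> n; apply: pre1; have [] := HF n.
      * by apply: bigcupT_measurable => n; apply: pre1; have [] := HF n.
      * move=> k l kl; apply/subsetPset => w /=.
        by move: (ndF _ _ kl) => /subsetPset; apply.
    have c2 : m2 [set w | F n (X2^~ w)] @[n --> \oo] -->
        m2 (\bigcup_i [set w | F i (X2^~ w)]).
      apply: nondecreasing_cvg_mu.
      * by move=> n; apply: pre2; have [] := HF n.
      * by apply: bigcupT_measurable => n; apply: pre2; have [] := HF n.
      * move=> k l kl; apply/subsetPset => w /=.
        by move: (ndF _ _ kl) => /subsetPset; apply.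
    rewrite e1 e2 -(cvg_lim _ c1)// -(cvg_lim _ c2)//.
    by apply/congr_lim/funext => n; have [] := HF n.
- move=> _ [B mB ->]; split; last exact: m12.
  by apply: sub_sigma_algebra; exists B.
Qed.

End LawUniqueness.

(** * Measurability of the chain events *)

Section Measurability.
Context {R : realType}.

Lemma measurable_invr : measurable_fun [set: R] (@GRing.inv R).
Proof.
have -> : [set: R] = [set x : R | x != 0] `|` [set 0].
  by apply/seteqP; split=> x //= _; have [->|] := eqVneq x 0; [right|left].
have o : open [set x : R | x != 0].
  rewrite (_ : [set x : R | x != 0] = ~` [set 0]).
    by apply: closed_openC; exact: closed_eq.
  by apply/seteqP; split=> x /= /eqP.
apply/measurable_funU => //; first exact: open_measurable.
split; last exact: measurable_fun_set1.
by apply: open_continuous_measurable_fun => // x; rewrite inE /= => x0; exact: inv_continuous.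
Qed.

Context d (Omega : measurableType d).
Implicit Types f g : Omega -> R.

Lemma measurable_funV f : measurable_fun setT f ->
  measurable_fun setT (fun w => (f w)^-1).
Proof. by move=> mf; exact: (measurableT_comp measurable_invr). Qed.

Context (I : finType) (X : I -> Omega -> R * R).

Lemma measurable_concave3 (p q r : Omega -> R * R) :
  measurable_fun setT p -> measurable_fun setT q -> measurable_fun setT r ->
  measurable_fun setT (fun w => concave3 (p w) (q w) (r w)).
Proof.
move=> mp mq mr; have m1 := measurableT_comp measurable_fst.
have m2 := measurableT_comp measurable_snd.
by apply: measurable_fun_ltr; apply: measurable_funM; apply: measurable_funB;
  first [exact: m1|exact: m2].
Qed.

Lemma measurable_G f : measurable_fun setT f ->
  measurable_fun setT (fun w => G (f w)).
Proof.
by move=> mf; apply: measurable_funM; [exact: measurable_funM|exact: measurable_funB].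
Qed.

Lemma measurable_in_cap (p : Omega -> R * R) : measurable_fun setT p ->
  measurable_fun setT (fun w => in_cap (p w)).
Proof.
move=> mp; have m1 := measurableT_comp measurable_fst mp.
have m2 := measurableT_comp measurable_snd mp.
by do 3?[apply: measurable_and]; apply: measurable_fun_ltr => //; exact: measurable_G.
Qed.

Lemma measurable_tie (p q : Omega -> R * R) :
  measurable_fun setT p -> measurable_fun setT q ->
  measurable_fun setT (fun w => tie (p w) (q w)).
Proof.
move=> mp mq; have m1 := measurableT_comp measurable_fst.
have m2 := measurableT_comp measurable_snd.
apply: measurable_or; apply: measurable_fun_eqr;
  [exact: m1|exact: m1| |];
  by apply: measurable_funM; [exact: m2|apply: measurable_G; exact: m1].
Qed.

Lemma measurable_cap_chain (A : {set I}) :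
  (forall j, j \in A -> measurable_fun setT (X j)) ->
  measurable [set w | cap_chain A (X^~ w)].
Proof.
move=> mX; apply: measurable_pred_and.
  apply: (@measurable_forall _ _ I (fun j w => j \in A -> in_cap (X j w))) => j.
  apply: measurable_imply => jA.
  by apply: measurable_bool; apply: measurable_in_cap; exact: mX.
(* The two ends become the points with index [inr false] and [inr true], so quantifying over points
   of the chain is quantifying over a finite type. *)
pose pt (k : I + bool) w := match k with inl j => X j w
  | inr b => (b%:R, 0) end.
pose dom (k : I + bool) := if k is inl j then j \in A else true.
have mpt k : dom k -> measurable_fun setT (pt k).
  by case: k => [j|b] /=; [exact: mX|move=> _; exact: measurable_cst].
rewrite (_ : [set w | _] = [set w | forall k1 k2 k3, dom k1 -> dom k2 -> dom k3 ->
    (pt k1 w).1 < (pt k2 w).1 -> (pt k2 w).1 < (pt k3 w).1 ->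
    concave3 (pt k1 w) (pt k2 w) (pt k3 w)]).
  do 3!(apply: measurable_forall => ?).
  do 3!(apply: measurable_imply => ?).
  have m1 := measurableT_comp measurable_fst.
  apply: measurable_pred_imply.
    by apply: measurable_bool; apply: measurable_fun_ltr; apply: m1; exact: mpt.
  apply: measurable_pred_imply.
    by apply: measurable_bool; apply: measurable_fun_ltr; apply: m1; exact: mpt.
  by apply: measurable_bool; apply: measurable_concave3; exact: mpt.
pose S w := X^~ w @` [set` A] `|` [set (0, 0); (1, 0)].
have toS w k : dom k -> S w (pt k w).
  by case: k => [j jA|[] _]; [left; exists j|right; right|right; left].
have ofS w p : S w p -> exists2 k, dom k & p = pt k w.
  move=> [[j jA <-]|[->|->]]; [by exists (inl j)| |].
    by exists (inr false).
  by exists (inr true).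
apply/seteqP; split=> w /= H.
  by move=> k1 k2 k3 d1 d2 d3; apply: H; exact: toS.
move=> p q r /ofS[k1 d1 ->] /ofS[k2 d2 ->] /ofS[k3 d3 ->]; exact: H.
Qed.

End Measurability.

Section SplitMeasurability.
Context {R : realType} d (Omega : measurableType d).

Lemma measurable_rescale (l a b : Omega -> R) (z : Omega -> R * R) :
  measurable_fun setT l -> measurable_fun setT a -> measurable_fun setT b ->
  measurable_fun setT z ->
  measurable_fun setT (fun w => rescale (l w) (a w) (b w) (z w)).
Proof.
move=> ml ma mb mz; have m1 := measurableT_comp measurable_fst mz.
have m2 := measurableT_comp measurable_snd mz.
apply: measurable_fun_pair; apply: measurable_funM.
- exact: measurable_funB.
- by apply: measurable_funV; exact: measurable_funB.
- apply: measurable_funB => //; apply: measurable_funM; first exact: measurable_funM.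
  apply: measurable_funD; last exact: measurable_funM.
  by apply: measurable_funM => //; apply: measurable_funB => //; exact: measurable_funB.
- apply: measurable_funV; apply: measurable_funM => //.
  by apply: measurable_funX; exact: measurable_funB.
Qed.

Lemma measurable_height (z : Omega -> R * R) : measurable_fun setT z ->
  measurable_fun setT (fun w => height (z w)).
Proof.
move=> mz; apply: measurable_funM.
  exact: (measurableT_comp measurable_snd mz).
by apply: measurable_funV; apply: measurable_G; exact: (measurableT_comp measurable_fst mz).
Qed.

Lemma measurable_split_chain (I : finType) (X : I -> Omega -> R * R) (A L : {set I}) i :
  i \in A -> L \subset A :\ i ->
  (forall j, j \in A -> measurable_fun setT (X j)) ->
  measurable [set w | split_chain A i L (X^~ w)].
Proof.
move=> iA LA mX.
have mXi := mX _ iA.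
have m1 := measurableT_comp measurable_fst mXi.
have mh := measurable_height mXi.
rewrite (_ : [set w | _] = [set w | in_cap (X i w)] `&`
  [set w | cap_chain L ((fun j w => rescaleL (X i w) (X j w))^~ w)] `&`
  [set w | cap_chain (A :\ i :\: L) ((fun j w => rescaleR (X i w) (X j w))^~ w)]).
  apply: measurableI; first apply: measurableI.
  - by apply: measurable_bool; exact: measurable_in_cap.
  - apply: measurable_cap_chain => j jL.
    have jA : j \in A by have := fintype.subsetP LA _ jL; rewrite !inE => /andP[].
    by apply: measurable_rescale => //; exact: mX.
  - apply: measurable_cap_chain => j; rewrite !inE => /andP[_ /andP[_ jA]].
    by apply: measurable_rescale => //; exact: mX.
by apply/seteqP; split=> w /= [] => [? ? ?|[? ?] ?]; split.
Qed.

End SplitMeasurability.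

(** * Areas *)

(** Change of variables is proved by uniqueness: a suitable multiple of the image measure is
    compared with Lebesgue measure on intervals, or with the area on rectangles. *)
Lemma scaled_pushforward (R : realType) d1 d2 (T1 : measurableType d1)
    (T2 : measurableType d2) (m : {measure set T1 -> \bar R}) (f : T1 -> T2)
    (r : {nonneg R}) : measurable_fun setT f ->
  exists m' : {measure set T2 -> \bar R},
    forall A, m' A = (r%:num%:E * m (f @^-1` A))%E.
Proof.
move=> mf.
unshelve eexists (mscale r (pushforward m f : {measure set T2 -> \bar R})).
  exact: mf.
by [].
Qed.

Section Area.
Context {R : realType}.
Local Notation leb := (@lebesgue_measure R).
Local Notation area := (leb \x leb)%E.

Lemma lebesgue_affine (s t : R) (A : set R) : 0 < s -> measurable A ->
  leb [set y | A ((y - t) / s)] = (s%:E * leb A)%E.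
Proof.
move=> s0 mA; have s0' : 0 <= s^-1 by rewrite invr_ge0 ltW.
pose f : R -> measurableTypeR R := fun y => (y - t) / s.
have mf : measurable_fun [set: R] f.
  by apply: measurable_funM => //; exact: measurable_funB.
have [m' m'E] := scaled_pushforward leb (NngNum s0') mf.
have E : leb A = m' A.
  apply: lebesgue_measure_unique => // _ [[a b]] _ <-.
  rewrite [RHS]m'E [in RHS]/=.
  have -> : f @^-1` [set` `]a, b]] = [set` `]s * a + t, s * b + t]].
    apply/seteqP; split=> y /=; rewrite !in_itv /= /f ltr_pdivlMr// ler_pdivrMr//;
    by move=> /andP[h1 h2]; apply/andP; split; lra.
  rewrite !lebesgue_measure_itv /= !lte_fin ltrD2r ltr_pM2l//.
  case: ifP => _; last by rewrite mule0.
  by rewrite -!EFinB -EFinM; congr (_%:E); field; rewrite gt_eqF.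
rewrite E m'E /= muleA -EFinM divff ?gt_eqF// mul1e.
by [].
Qed.

(** Each vertical section is translated and dilated by [s], with a translation depending on the
    abscissa, so the one-dimensional formula applies under the integral. *)
Lemma area_shear (s : R) (t : R -> R) (C : set (R * R)) : 0 < s ->
  measurable_fun setT t -> measurable C ->
  area [set z | C (z.1, (z.2 - t z.1) / s)] = (s%:E * area C)%E.
Proof.
move=> s0 mt mC; rewrite /product_measure1 -ge0_integralZl//; last 2 first.
  exact: measurable_fun_xsection.
  by rewrite lee_fin ltW.
apply: eq_integral => x _ /=.
rewrite -(lebesgue_affine (t x))//; last exact: measurable_xsection.
Qed.

Lemma area_stretch (s a : R) (C : set (R * R)) : 0 < s -> measurable C ->
  area [set z | C ((z.1 - a) / s, z.2)] = (s%:E * area C)%E.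
Proof.
move=> s0 mC; have s0' : 0 <= s^-1 by rewrite invr_ge0 ltW.
pose f (z : R * R) : measurableTypeR R * measurableTypeR R := ((z.1 - a) / s, z.2).
have mf : measurable_fun [set: R * R] f.
  apply: measurable_fun_pair => //; apply: measurable_funM => //.
  exact: measurable_funB.
have [m' m'E] := scaled_pushforward area (NngNum s0') mf.
have E : area C = m' C.
  apply: product_measure_unique => //= A B mA mB.
  rewrite [LHS]m'E [in LHS]/=.
  have -> : f @^-1` (A `*` B) = [set x | A ((x - a) / s)] `*` B by [].
  rewrite product_measure1E//; last first.
    have : measurable_fun setT (fun x : R => (x - a) / s).
      by apply: measurable_funM => //; exact: measurable_funB.
    by move=> /(_ measurableT A mA); rewrite setTI.
  transitivity ((s^-1)%:E * (leb [set x | A ((x - a) / s)%R] * leb B))%E => //.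
  rewrite (lebesgue_affine a s0 mA) !muleA -EFinM mulVf ?gt_eqF// mul1e//.
rewrite E m'E /= muleA -EFinM divff ?gt_eqF// mul1e.
by [].
Qed.

(** [rescale] is a shear along the chord with vertical factor [l * (b - a) ^+ 2], followed by a
    horizontal stretch with factor [b - a]. *)
Lemma area_rescale (l a b : R) (C : set (R * R)) : 0 < l -> a < b ->
  measurable C ->
  area (rescale l a b @^-1` C) = ((l * (b - a) ^+ 3)%:E * area C)%E.
Proof.
move=> l0 ab mC; have ba : 0 < b - a by rewrite subr_gt0.
have s0 : 0 < l * (b - a) ^+ 2 by rewrite mulr_gt0// exprn_gt0.
pose t (x : R) := 6 * l * ((1 - a - b) * x + a * b).
have mt : measurable_fun setT t.
  by do 2?[apply: measurable_funM => //]; apply: measurable_funD => //; exact: measurable_funM.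
pose C1 := [set z : R * R | C ((z.1 - a) / (b - a), z.2)].
have mC1 : measurable C1.
  have mf : measurable_fun [set: R * R] (fun z : R * R => ((z.1 - a) / (b - a), z.2)).
    apply: measurable_fun_pair => //; apply: measurable_funM => //.
    exact: measurable_funB.
  by have := mf measurableT C mC; rewrite setTI.
transitivity (area [set z | C1 (z.1, (z.2 - t z.1) / (l * (b - a) ^+ 2))]).
  by [].
rewrite (area_shear s0 mt mC1) (area_stretch a ba mC) muleA -EFinM; congr ((_%:E * _)%E); ring.
Qed.

Lemma area_null (C : set (R * R)) : measurable C ->
  (forall x, finite_set (xsection C x)) -> area C = 0%E.
Proof.
move=> mC fC; rewrite /product_measure1 integral0_eq// => x _ /=.
exact: countable_lebesgue_measure0 (finite_set_countable (fC x)).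
Qed.

Lemma measurable_cap : measurable [set z : R * R | in_cap z].
Proof. by apply: measurable_bool; apply: measurable_in_cap; exact: measurable_id. Qed.
End Area.

(** * Null sets in the region and the beta integral over the cap *)

Section AreaD.
Context {R : realType}.
Local Notation leb := (@lebesgue_measure R).
Local Notation area := (leb \x leb)%E.

Lemma measurable_D : measurable (@D R).
Proof.
have m1 := @measurable_fst _ _ R R; have m2 := @measurable_snd _ _ R R.
rewrite (_ : @D R = [set z : R * R | [&& 0 <= z.1, z.1 <= 1, 0 <= z.2 & z.2 <= G z.1]]).
  apply: measurable_bool; do 3?[apply: measurable_and];
    by apply: measurable_fun_ler => //; exact: measurable_G.
apply/seteqP; split=> z /=; first by move=> [/andP[-> ->] /andP[-> ->]].
by move=> /and4P[h1 h2 h3 h4]; split; apply/andP.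
Qed.

Lemma cap_sub_D : [set z | in_cap z] `<=` @D R.
Proof. by move=> z /and4P[/ltW h1 /ltW h2 /ltW h3 /ltW h4]; split; apply/andP. Qed.

Lemma area_D_cap : area (@D R `\` [set z | in_cap z]) = 0%E.
Proof.
apply: area_null.
  by apply: measurableD; [exact: measurable_D|exact: measurable_cap].
move=> x; apply: (@sub_finite_set _ _ [set 0; G x]); last first.
  by rewrite finite_setU; split; exact: finite_set1.
move=> y; rewrite /xsection /= inE => -[[/= /andP[x0 x1] /andP[y0 yG]] ncap].
have [y00|y00] := eqVneq y 0; first by left.
right; apply/eqP; apply/negPn/negP => yG'; apply: ncap.
have yp : 0 < y by rewrite lt_def y00.
have [xx|xx] := eqVneq x 0; first by move: yG yp; rewrite /G xx; lra.
have [xx1|xx1] := eqVneq x 1; first by move: yG yp; rewrite /G xx1; lra.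
apply/and4P; split => //=.
- by rewrite lt_def xx.
- by rewrite lt_def eq_sym xx1.
- by rewrite lt_def eq_sym yG'.
Qed.

(** The points tied with [z] lie on the vertical line through [z] or on the graph of
    [height z * G]. *)
Lemma area_tie (z : R * R) : in_cap z ->
  area ([set w | tie z w] `&` @D R) = 0%E.
Proof.
move=> cz; have /and4P[x0 x1 _ _] := cz.
have mT : measurable [set w : R * R | z.2 * G w.1 == w.2 * G z.1].
  apply: measurable_bool; apply: measurable_fun_eqr; apply: measurable_funM => //.
  exact: measurable_G.
have e0 : area ([set z.1] `*` setT) = 0%E.
  by rewrite product_measure1E// [X in (X * _)%E]lebesgue_measure_set1 mul0e.
have e1 : area [set w : R * R | z.2 * G w.1 == w.2 * G z.1] = 0%E.
  apply: area_null => // x.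
  apply: (@sub_finite_set _ _ [set z.2 * G x / G z.1]); last exact: finite_set1.
  move=> y; rewrite /xsection /= inE => /eqP /= ->.
  by rewrite mulfK// gt_eqF// G_gt0.
have mtie : measurable [set w : R * R | tie z w].
  by apply: measurable_bool; apply: measurable_tie => //; exact: measurable_id.
apply/eqP; rewrite eq_le measure_ge0 andbT.
apply: (@le_trans _ _ (area ([set z.1] `*` setT `|` [set w : R * R | z.2 * G w.1 == w.2 * G z.1]))).
  apply: le_measure; rewrite ?inE.
  - by apply: measurableI => //; exact: measurable_D.
  - by apply: measurableU => //; exact: measurableX.
  - by move=> w [/= /orP[/eqP ->|h] _]; [left|right].
rewrite measureU0//; first by rewrite le_eqVlt; apply/orP; left; apply/eqP; exact: e0.
exact: measurableX.
Qed.

Lemma integral_expr (g : R) (N : nat) : 0 < g ->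
  (\int[leb]_(y in `]0%R, g[) ((y / g) ^+ N)%:E = (g / N.+1%:R)%:E)%E.
Proof.
move=> g0.
have mf : measurable_fun `]0%R, g[ (fun y : R => ((y / g) ^+ N)%:E).
  apply/measurable_EFinP; apply: measurable_funX; apply: measurable_funM => //.
rewrite -(@integral_itv_bndoo _ 0 g _ true false)//.
pose c : R := (N.+1%:R * g ^+ N)^-1.
rewrite (@continuous_FTC2 _ _ (fun y => y ^+ N.+1 * c))//.
- rewrite expr0n /= mul0r sube0 /c exprS; congr (_%:E); field.
  by rewrite expf_neq0 ?gt_eqF//= nat1r.
- apply: continuous_subspaceT => x; apply: (@continuous_comp _ _ _ (fun y : R => y / g) (fun y => y ^+ N)).
    by apply: cvgM; [exact: cvg_id|exact: cvg_cst].
  exact: exprn_continuous.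
- split.
  + by move=> y _; apply: derivableM => //; exact: exprn_derivable.
  + by apply: cvg_at_right_filter; apply: cvgM; [exact: exprn_continuous|exact: cvg_cst].
  + by apply: cvg_at_left_filter; apply: cvgM; [exact: exprn_continuous|exact: cvg_cst].
- move=> x _; rewrite derive1Mr//; last exact: exprn_derivable.
  rewrite derive1E exp_derive /= /c exprMn exprVn.
  rewrite [_ *: _](_ : _ = N.+1%:R * x ^+ N).
    by field; rewrite expf_neq0 ?gt_eqF//= nat1r.
  by rewrite /GRing.scale /= mulr1.
Qed.

(** Integrating the power [k + m] of the height over a vertical section gives [G x / (k + m).+1],
    that is [6 * x * (1 - x) / (k + m).+1]. The extra factor [x * (1 - x)] raises the exponents
    [3 * k] and [3 * m] by one, and the beta integral with parameters [3 * k + 2] and [3 * m + 2]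
    remains. *)
Lemma integral_cap (k m : nat) :
  (\int[area]_(z in [set z | in_cap z])
     ((height z * z.1 ^+ 3) ^+ k * (height z * (1 - z.1) ^+ 3) ^+ m)%:E =
   (6 / (k + m).+1%:R *
     ((3 * k + 1)`!%:R * (3 * m + 1)`!%:R / (3 * (k + m).+1)`!%:R))%:E)%E.
Proof.
pose h (z : R * R) : R :=
  (height z * z.1 ^+ 3) ^+ k * (height z * (1 - z.1) ^+ 3) ^+ m.
transitivity (\int[area]_(z in [set z | in_cap z]) (h z)%:E)%E => //.
have mh : measurable_fun setT h.
  have m1 := @measurable_fst _ _ R R.
  have mH := measurable_height (@measurable_id _ (R * R)%type setT).
  by apply: measurable_funM; apply: measurable_funX; apply: measurable_funM => //;
    apply: measurable_funX => //; exact: measurable_funB.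
have mp : measurable_fun setT ((EFin \o h) \_ [set z | in_cap z]).
  apply/measurable_restrict => //; first exact: measurable_cap.
  by rewrite setTI; apply/measurable_EFinP; exact: measurable_funS mh.
have h0 z : in_cap z -> 0 <= h z.
  move=> cz; have /and4P[z0 z1 _ _] := cz; have hz := ltW (height_gt0 cz).
  rewrite /h mulr_ge0// exprn_ge0// mulr_ge0// exprn_ge0 ?(ltW z0)//.
  by rewrite subr_ge0 ltW.
rewrite integral_mkcond fubini_tonelli1//; last first.
  move=> z; rewrite patchE; case: ifPn => //; rewrite inE /= => /h0.
  by rewrite lee_fin.
have c0 : 0 <= 6 / (k + m).+1%:R :> R by rewrite divr_ge0.
transitivity (\int[leb]_x ((6 / (k + m).+1%:R)%:E *
    (((@XMonemX R (3 * k + 2).-1 (3 * m + 2).-1) \_`[0%R, 1%R]) x)%:E)%E)%E.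
  apply: eq_integral => x _; rewrite /fubini_F.
  rewrite [in RHS]patchE mem_setE in_itv /=.
  have [xx|xx] := boolP ((0 < x) && (x < 1)); last first.
    rewrite integral0_eq; last first.
      move=> y _; rewrite patchE ifN//; rewrite notin_setE /= /in_cap /=.
      by move=> /and4P[a b _ _]; move: xx; rewrite a b.
    case: ifP => [/andP[x0 x1]|_]; last by rewrite mule0.
    (* The beta integrand lives on the closed interval; both exponents are positive, so it vanishes
       at the endpoints, which the open cap omits. *)
    suff -> : @XMonemX R (3 * k + 2).-1 (3 * m + 2).-1 x = 0 by rewrite mule0.
    have [->|xn0] := eqVneq x 0; first by rewrite /XMonemX addn2 /= exprS !mul0r.
    have [->|xn1] := eqVneq x 1.
      by rewrite /XMonemX !addn2 /= [onem 1 ^+ _]exprS onem1 mul0r mulr0.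
    by move: xx; rewrite !lt_def xn0 (eq_sym 1) xn1 x0 x1.
  have /andP[x0 x1] := xx; rewrite (ltW x0) (ltW x1) /=.
  have g0 := G_gt0 x0 x1.
  pose cc : R := (x ^+ 3) ^+ k * ((1 - x) ^+ 3) ^+ m.
  have cc0 : 0 <= cc by rewrite mulr_ge0// !exprn_ge0// ?subr_ge0 ltW.
  transitivity (\int[leb]_(y in `]0%R, G x[) (cc%:E * ((y / G x) ^+ (k + m))%:E))%E.
    rewrite [RHS]integral_mkcond; apply: eq_integral => y _.
    have E1 : ((x, y) \in [set z : R * R | in_cap z]) = (0 < y) && (y < G x).
      by apply/idP/idP; rewrite inE /= /in_cap /= x0 x1.
    have E2 : (y \in [set` `]0%R, G x[]) = (0 < y) && (y < G x).
      by rewrite mem_setE in_itv.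
    rewrite !patchE E1 E2; case: ifP => // _; rewrite -EFinM; congr (_%:E).
    by rewrite /h /cc /height /= !exprMn !exprD; ring.
  rewrite ge0_integralZl//; last 2 first.
  - apply/measurable_EFinP; apply: measurable_funX; exact: measurable_funM.
  - move=> y; rewrite /= in_itv /= => /andP[y0 _].
    by rewrite lee_fin exprn_ge0// divr_ge0// ltW.
  rewrite integral_expr// -!EFinM; congr (_%:E).
  rewrite /cc /G /XMonemX /onem !addn2 /= -!exprM !exprS; field.
  by rewrite -natrD nat1r pnatr_eq0.
rewrite ge0_integralZl//; last 2 first.
- apply/measurable_EFinP; apply/measurable_restrict => //.
  rewrite setTI; apply: measurable_funM; first exact: measurable_funX.
  by apply: measurable_funX; exact: measurable_funB.
- by move=> x _; rewrite lee_fin patchE; case: ifP => //; rewrite inE; exact: XMonemX_ge0.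
rewrite -EFin_beta_fun -EFinM !addn2 beta_fun_fact natrM !addn1.
by congr ((_ * (_ / _`!%:R))%:E); rewrite !addSn !addnS -mulnDr !mulnS.
Qed.

(** This is the normalisation behind the 6 in [G]: integrating 1 over the cap is the case
    [k = m = 0] of [integral_cap], with value [6 * (1 / 3!)]. *)
Lemma area_D : area (@D R) = 1%E.
Proof.
rewrite -(setDUK (@cap_sub_D)) measureU0//; last 3 first.
- exact: measurable_cap.
- by apply: measurableD; [exact: measurable_D|exact: measurable_cap].
- exact: area_D_cap.
have := integral_cap 0 0.
rewrite (eq_integral (fun=> 1%E)); last by move=> z _; rewrite !expr0 mulr1.
rewrite integral_cst//; last exact: measurable_cap.
rewrite mul1e => ->; congr (_%:E).
by rewrite !muln0 /= !add0n muln1 /factorial /=; field.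
Qed.

End AreaD.

(** * The recurrence *)

Section FussCatalan.
Context {R : numFieldType}.

(* The coefficient of x^n in B^r, where B = 1 + x B^3. *)
Definition fuss_catalan (n r : nat) : R :=
  if n is 0 then 1 else
  r%:R * ((3 * n + r).-1)`!%:R / (n`!%:R * (2 * n + r)`!%:R).

Arguments fuss_catalan : simpl never.

Lemma fuss_catalan0 r : fuss_catalan 0 r = 1. Proof. by []. Qed.

Lemma fuss_catalanE n r : fuss_catalan n r.+1 =
  r.+1%:R * (3 * n + r)`!%:R / (n`!%:R * (2 * n + r.+1)`!%:R).
Proof.
case: n => [|n]; last by rewrite /fuss_catalan addnS.
by rewrite fuss_catalan0 !muln0 !add0n fact0 mul1r -natrM -factS divff// pnatr_eq0 -lt0n fact_gt0.
Qed.

(** The equation [B = 1 + x B^3] multiplied by [B^r], read at the coefficient of [x^(n+1)]. *)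
Lemma fuss_catalanS n r : fuss_catalan n.+1 r.+1 =
  fuss_catalan n.+1 r + fuss_catalan n r.+3.
Proof.
rewrite (fuss_catalanE n) (fuss_catalanE n.+1).
have -> : fuss_catalan n.+1 r =
  r%:R * ((3 * n.+1 + r).-1)`!%:R / (n.+1`!%:R * (2 * n.+1 + r)`!%:R) by [].
have -> : ((3 * n.+1 + r).-1 = 3 * n + r.+2)%N by lia.
have -> : (3 * n.+1 + r = (3 * n + r.+2).+1)%N by lia.
have -> : (2 * n.+1 + r.+1 = (2 * n + r.+2).+1)%N by lia.
have -> : (2 * n.+1 + r = 2 * n + r.+2)%N by lia.
have -> : (2 * n + r.+3 = (2 * n + r.+2).+1)%N by lia.
rewrite !factS !natrM.
have h k : (k`!)%:R != 0 :> R by rewrite pnatr_eq0 -lt0n fact_gt0.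
have h1 := h (2 * n + r.+2)%N; have h2 := h n.
have e1 : (2 * n + r.+2).+1%:R = 2 * n%:R + r%:R + 3 :> R.
  by rewrite -natrM -!natrD; congr (_%:R); lia.
have e2 : (3 * n + r.+2).+1%:R = 3 * n%:R + r%:R + 3 :> R.
  by rewrite -natrM -!natrD; congr (_%:R); lia.
have e3 : n.+1%:R = n%:R + 1 :> R by rewrite natr1.
have e4 : r.+1%:R = r%:R + 1 :> R by rewrite natr1.
have e5 : r.+3%:R = r%:R + 3 :> R by rewrite -natrD; congr (_%:R); lia.
have e6 : 2 * n%:R + r%:R + 3 != 0 :> R by rewrite -e1 pnatr_eq0.
have e7 : n%:R + 1 != 0 :> R by rewrite natr1 pnatr_eq0.
rewrite e1 e2 e3 e4 e5.
move: h1 h2; move: ((2 * n + r.+2)`!%:R) (n`!%:R) ((3 * n + r.+2)`!%:R) => a b c ha hb.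
by field; rewrite ha hb e6 e7.
Qed.

(** The identity [B^r * B^s = B^(r+s)]. Both sides obey the rule of [fuss_catalanS], which lowers
    either [r] or [n]; hence an induction on [r] inside one on [n], starting from [B^0 = 1]. *)
Lemma fuss_catalan_conv n r s :
  \sum_(k < n.+1) fuss_catalan k r * fuss_catalan (n - k) s =
  fuss_catalan n (r + s).
Proof.
elim: n r s => [|n IH] r s; first by rewrite big_ord1 !fuss_catalan0 mul1r.
elim: r => [|r IHr].
  rewrite big_ord_recl /= fuss_catalan0 mul1r subn0 add0n big1 ?addr0// => i _.
  by rewrite /fuss_catalan /= !mul0r.
rewrite addSn fuss_catalanS -IHr -(IH r.+3 s).
rewrite big_ord_recl [in RHS]big_ord_recl -addrA; congr (_ + _).
rewrite -big_split /=; apply: eq_bigr => k _.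
by rewrite /bump /= add1n subSS fuss_catalanS mulrDl.
Qed.

(** The binomial absorbs [k!] and [(n - k)!], leaving the common factor [12^n n! / (3n+3)!]. The
    numerator [(3n+3)!] of the coefficient of [B^4] cancels its denominator, and the constants match
    because [6 * 4 = 12^2 / 6]. *)
Lemma chain_prob_recurrence n :
  6 * \sum_(k < n.+1) ('C(n, k)%:R *
     ((3 * k + 1)`!%:R * (3 * (n - k) + 1)`!%:R / (3 * n.+1)`!%:R) *
     (12 ^+ k.+1 / (6 * (2 * k + 2)`!%:R)) *
     (12 ^+ (n - k).+1 / (6 * (2 * (n - k) + 2)`!%:R))) =
  12 ^+ n.+2 / (6 * (2 * n.+1 + 2)`!%:R) :> R.
Proof.
have h k : (k`!)%:R != 0 :> R by rewrite pnatr_eq0 -lt0n fact_gt0.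
transitivity (6 * (12 ^+ n * n`!%:R / (3 * n.+1)`!%:R *
   \sum_(k < n.+1) fuss_catalan k 2 * fuss_catalan (n - k) 2) : R).
  congr (_ * _); rewrite big_distrr /=; apply: eq_bigr => k _.
  have kn : (k <= n)%N by rewrite -ltnS.
  move: ((3 * n.+1)`!%:R) (h (3 * n.+1)%N) => c h5.
  rewrite !fuss_catalanE -(bin_fact kn) !natrM.
  have -> : 12 ^+ n = 12 ^+ k * 12 ^+ (n - k) :> R by rewrite -exprD subnKC.
  rewrite !exprS.
  have h1 := h (2 * k + 2)%N; have h2 := h (2 * (n - k) + 2)%N.
  have h3 := h k; have h4 := h (n - k)%N;
  by field; rewrite h1 h2 h3 h4 h5.
rewrite fuss_catalan_conv fuss_catalanE.
have -> : (3 * n + 3 = 3 * n.+1)%N by lia.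
have -> : (2 * n + 4 = 2 * n.+1 + 2)%N by lia.
rewrite !exprS.
have h1 := h (2 * n.+1 + 2)%N; have h2 := h n; have h3 := h (3 * n.+1)%N.
by field; rewrite ?h1 ?h2 ?h3.
Qed.

End FussCatalan.

(** * Chains and convex position *)

Section ChainPosition.
Context {R : realType} {I : finType}.
Implicit Types z : I -> R * R.

Let with_ends z : set (R * R) := [set z i | i in [set: I]] `|` [set (0, 0); (1, 0)].

Lemma finite_with_ends z : finite_set (with_ends z).
Proof.
rewrite /with_ends !finite_setU; split; first exact/finite_image/finite_finset.
by split; exact: finite_set1.
Qed.

(** A functional separating the middle point [b] from both ends must point upwards. Weighting its
    inequalities against [a] and [c] by the horizontal distances then eliminates its first
    coordinate and leaves [concave3]. *)
Lemma position_chain z : (forall j, in_cap (z j)) ->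
  in_convex_position (with_ends z) -> concave_chain (with_ends z).
Proof.
move=> zcap; have S0 : with_ends z (0, 0) by right; left.
have S1 : with_ends z (1, 0) by right; right.
move=> /(in_convex_positionP (finite_with_ends z) S0 S1)[_ H].
have Sx p : with_ends z p -> 0 <= p.1 <= 1.
  move=> [[j _ <-]|[->|->]] /=; rewrite ?lexx ?ler01//.
  by have /and4P[/ltW -> /ltW -> _ _] := zcap j.
move=> a b c Sa Sb Sc ab bc.
have cb : in_cap b.
  case: Sb ab bc => [[j _ <-]//|[->|->]] /= h1 h2.
    by have := Sx _ Sa; rewrite leNgt h1.
  by have := Sx _ Sc; rewrite [X in _ && X]leNgt h2 andbF.
have /and4P[x0 x1 y0 _] := cb.
have [u Hu] := H _ Sb.
have Ha : dot u a < dot u b.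
  by have [E|//] := Hu _ Sa; move: ab; rewrite E ltxx.
have Hc : dot u c < dot u b.
  by have [E|//] := Hu _ Sc; move: bc; rewrite E ltxx.
have H0 : dot u (0, 0) < dot u b.
  by have [E|//] := Hu _ S0; move: x0; rewrite -E /= !ltxx.
have H1 : dot u (1, 0) < dot u b.
  by have [E|//] := Hu _ S1; move: x1; rewrite -E /= !ltxx.
rewrite /dot /= in Ha Hc H0 H1.
(* The inequalities against [(0, 0)] and [(1, 0)], weighted by [1 - b.1] and [b.1], add up to
   [0 < u.2 * b.2]. *)
have u2 : 0 < u.2.
  rewrite -(pmulr_lgt0 _ y0).
  have h1 : 0 < (1 - b.1) * (u.1 * b.1 + u.2 * b.2 - (u.1 * 0 + u.2 * 0)).
    by apply: mulr_gt0; lra.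
  have h2 : 0 < b.1 * (u.1 * b.1 + u.2 * b.2 - (u.1 * 1 + u.2 * 0)).
    by apply: mulr_gt0; lra.
  by lra.
rewrite /concave3 -subr_gt0 -(pmulr_rgt0 _ u2).
have ab' : 0 < b.1 - a.1 by lra.
have bc' : 0 < c.1 - b.1 by lra.
have h1 : 0 < (c.1 - b.1) * (u.1 * b.1 + u.2 * b.2 - (u.1 * a.1 + u.2 * a.2)).
  by apply: mulr_gt0; lra.
have h2 : 0 < (b.1 - a.1) * (u.1 * b.1 + u.2 * b.2 - (u.1 * c.1 + u.2 * c.2)).
  by apply: mulr_gt0; lra.
by lra.
Qed.

Lemma chain_position z (i0 : I) : (forall j, in_cap (z j)) ->
  (forall j k, j != k -> (z j).1 != (z k).1) ->
  concave_chain (with_ends z) -> in_convex_position (with_ends z).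
Proof.
move=> zcap dist Hc; have S0 : with_ends z (0, 0) by right; left.
have S1 : with_ends z (1, 0) by right; right.
have Sz j : with_ends z (z j) by left; exists j.
apply/(in_convex_positionP (finite_with_ends z) S0 S1); split.
  by exists (z i0) => //; have /and4P[_ _ y0 _] := zcap i0; rewrite gt_eqF.
(* The tangents to [G] at the ends have slopes 6 and -6 and pass strictly above the cap; they
   separate the two ends. *)
have steep j : (z j).2 < 6 * (z j).1 /\ (z j).2 < 6 * (1 - (z j).1).
  have /and4P[x0 x1 y0] := zcap j; rewrite /G => yG.
  have k0 : 0 < 1 - (z j).1 by lra.
  have k1 := mulr_gt0 x0 x0; have k2 := mulr_gt0 k0 k0.
  by split; lra.
move=> v [[j _ <-]|[->|->]]; last 2 first.
- exists (-6, 1) => t [[j _ <-]|[->|->]]; [right|by left|right].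
    by rewrite /dot /=; have [] := steep j; lra.
  by rewrite /dot /=; lra.
- exists (6, 1) => t [[j _ <-]|[->|->]]; [right|right|by left].
    by rewrite /dot /=; have [_] := steep j; lra.
  by rewrite /dot /=; lra.
have /and4P[x0 x1 y0 _] := zcap j.
pose slope (p : R * R) := (p.2 - (z j).2) / (p.1 - (z j).1).
pose lft := [seq z k | k <- enum I & (z k).1 < (z j).1].
pose rgt := [seq z k | k <- enum I & (z j).1 < (z k).1].
have lftP p : p \in (0, 0) :: lft -> with_ends z p /\ p.1 < (z j).1.
  rewrite inE => /orP[/eqP ->|/mapP[k]]; first by split.
  by rewrite mem_filter => /andP[h _] ->; split.
have rgtP p : p \in (1, 0) :: rgt -> with_ends z p /\ (z j).1 < p.1.
  rewrite inE => /orP[/eqP ->|/mapP[k]]; first by split.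
  by rewrite mem_filter => /andP[h _] ->; split.
have [a al Ha] := seq_argmax (0, 0) lft (fun p => - slope p).
have [c cr Hr] := seq_argmax (1, 0) rgt slope.
have [Sa ax] := lftP _ al; have [Sc cx] := rgtP _ cr.
have ac : slope c < slope a.
  have := Hc _ _ _ Sa (Sz j) Sc ax cx; rewrite /concave3 => K.
  have -> : slope a = ((z j).2 - a.2) / ((z j).1 - a.1).
    by rewrite /slope -[RHS]mulrNN -invrN !opprB.
  rewrite ltr_pdivrMr ?subr_gt0// mulrAC ltr_pdivlMr ?subr_gt0//.
(* [slope a] is the least slope between [z j] and a point on its left, [slope c] the greatest for a
   point on its right. The line through [z j] with a slope strictly between them has all other
   points strictly below it. *)
pose s := (slope a + slope c) / 2.
exists (- s, 1) => t St.
have below p : with_ends z p -> (p.1 < (z j).1 /\ s < slope p) \/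
   ((z j).1 < p.1 /\ slope p < s) -> dot (- s, 1) p < dot (- s, 1) (z j).
  move=> _; rewrite /dot /= => -[[h K]|[h K]].
    have h' : 0 < (z j).1 - p.1 by lra.
    have : 0 < (slope p - s) * ((z j).1 - p.1) by apply: mulr_gt0; lra.
    have -> : (slope p - s) * ((z j).1 - p.1) =
       (z j).2 - p.2 - s * ((z j).1 - p.1).
      by rewrite /slope; field; rewrite lt_eqF// subr_lt0.
    by lra.
  have h' : 0 < p.1 - (z j).1 by lra.
  have : 0 < (s - slope p) * (p.1 - (z j).1) by apply: mulr_gt0; lra.
  have -> : (s - slope p) * (p.1 - (z j).1) =
     (z j).2 - p.2 + s * (p.1 - (z j).1).
    by rewrite /slope; field; rewrite gt_eqF// subr_gt0.
  by lra.
have bl p : p \in (0, 0) :: lft -> dot (- s, 1) p < dot (- s, 1) (z j).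
  move=> pl; have [Sp px] := lftP _ pl; apply: below => //; left; split => //.
  by have := Ha _ pl; rewrite /s; lra.
have br p : p \in (1, 0) :: rgt -> dot (- s, 1) p < dot (- s, 1) (z j).
  move=> pl; have [Sp px] := rgtP _ pl; apply: below => //; right; split => //.
  by have := Hr _ pl; rewrite /s; lra.
case: St => [[k _ <-]|[->|->]].
- have [->|kj] := eqVneq k j; [by left|right].
  have := dist _ _ kj; rewrite neq_lt => /orP[h|h].
    by apply: bl; rewrite inE; apply/orP; right; apply/mapP; exists k => //;
      rewrite mem_filter h mem_enum inE.
  by apply: br; rewrite inE; apply/orP; right; apply/mapP; exists k => //;
    rewrite mem_filter h mem_enum inE.
- by right; apply: bl; exact: mem_head.
- by right; apply: br; exact: mem_head.
Qed.

Lemma measurable_position d (Omega : measurableType d) (X : I -> Omega -> R * R) :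
  (forall j, measurable_fun setT (X j)) ->
  measurable [set w | in_convex_position (with_ends (X^~ w))].
Proof.
move=> mX.
pose pt (k : I + bool) w := match k with inl j => X j w | inr b => (b%:R, 0) end.
have mpt k : measurable_fun setT (pt k).
  by case: k => [j|b]; [exact: mX|exact: measurable_cst].
have m1 k : measurable_fun setT (fun w => (pt k w).1).
  exact: (measurableT_comp measurable_fst (mpt k)).
have m2 k : measurable_fun setT (fun w => (pt k w).2).
  exact: (measurableT_comp measurable_snd (mpt k)).
have toS w k : with_ends (X^~ w) (pt k w).
  by case: k => [j|[]]; [left; exists j|right; right|right; left].
have ofS w p : with_ends (X^~ w) p -> exists k, p = pt k w.
  move=> [[j _ <-]|[->|->]]; [by exists (inl j)| |].
    by exists (inr false).
  by exists (inr true).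
rewrite (_ : [set w | _] =
  [set w | (exists k, (pt k w).2 != 0) /\
     forall k, exists r : rat * rat, forall k',
       ((pt k' w).1 == (pt k w).1 /\ (pt k' w).2 == (pt k w).2) \/
       dot (ratr r.1, ratr r.2) (pt k' w) < dot (ratr r.1, ratr r.2) (pt k w)]).
  apply: measurable_pred_and.
    apply: measurable_exists => k; apply: measurable_bool.
    by apply: measurable_neg; apply: measurable_fun_eqr; [exact: m2|exact: measurable_cst].
  apply: measurable_forall => k; apply: measurable_exists => r.
  apply: measurable_forall => k'; apply: measurable_pred_or.
    by apply: measurable_pred_and; apply: measurable_bool;
      apply: measurable_fun_eqr; first [exact: m1|exact: m2].
  by apply: measurable_bool; apply: measurable_fun_ltr; apply: measurable_funD;
    apply: measurable_funM; first [exact: m1|exact: m2|exact: measurable_cst].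
apply/seteqP; split=> w /=.
  move=> /in_convex_positionP[]; [exact: finite_with_ends|exact: (toS w (inr false))
    |exact: (toS w (inr true))|].
  move=> [v /ofS[k ->] vk] H; split; first by exists k.
  move=> {k vk}k; have [u Hu] := H _ (toS w k).
  (* [rational_near] compares with 0, hence the differences; points coinciding with [pt k w] satisfy
     no strict inequality and are left out. *)
  pose D := [seq ((pt k' w).1 - (pt k w).1, (pt k' w).2 - (pt k w).2) |
    k' <- enum {: I + bool} & pt k' w != pt k w].
  have [x|r Hr] := @rational_near R D u.
    move=> /mapP[k']; rewrite mem_filter => /andP[ne _] ->.
    have [E|] := Hu _ (toS w k'); first by rewrite E eqxx in ne.
    by rewrite /dot /=; lra.
  exists r => k'; have [->|ne] := eqVneq (pt k' w) (pt k w); [by left|right].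
  have := Hr ((pt k' w).1 - (pt k w).1, (pt k' w).2 - (pt k w).2).
  rewrite /dot /= => K.
  suff : ((pt k' w).1 - (pt k w).1, (pt k' w).2 - (pt k w).2) \in D by move/K; lra.
  by apply/mapP; exists k' => //; rewrite mem_filter ne mem_enum.
move=> [[k vk] H].
apply/in_convex_positionP; [exact: finite_with_ends|exact: (toS w (inr false))
    |exact: (toS w (inr true))|].
split; first by exists (pt k w).
move=> v /ofS[k1 ->]; have [r Hr] := H k1.
exists (ratr r.1, ratr r.2) => t /ofS[k2 ->].
case: (Hr k2) => [[/eqP e1 /eqP e2]|]; [left|by right].
by rewrite [LHS]surjective_pairing e1 e2 -surjective_pairing.
Qed.

End ChainPosition.

(** * Probability of a concave chain *)

Section FiniteAdditivity.
Context {R : realType} d (T : measurableType d) (mu : {measure set T -> \bar R}).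

Lemma measure_exists (K : finType) (Q : pred K) (F : K -> set T) :
  (forall k, Q k -> measurable (F k)) ->
  (forall k k' x, Q k -> Q k' -> F k x -> F k' x -> k = k') ->
  mu [set x | exists2 k, Q k & F k x] = (\sum_(k | Q k) mu (F k))%E.
Proof.
move=> mF disj.
have H (s : seq K) : uniq s ->
    measurable [set x | exists2 k, (k \in s) && Q k & F k x] /\
    mu [set x | exists2 k, (k \in s) && Q k & F k x] =
    (\sum_(k <- s | Q k) mu (F k))%E.
  elim: s => [_|k s IH /= /andP[ks us]].
    rewrite (_ : [set x | _] = set0); last by apply/seteqP; split=> x // [].
    by rewrite big_nil measure0.
  have [mS ES] := IH us; rewrite big_cons.
  have [Qk|nQk] := boolP (Q k); last first.
    rewrite (_ : [set x | _] = [set x | exists2 k, (k \in s) && Q k & F k x])//.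
    apply/seteqP; split=> x [l /andP[ls Ql] Fl]; exists l => //.
      rewrite inE in ls; case/orP: ls => [/eqP lk|->//].
      by rewrite lk (negbTE nQk) in Ql.
    by rewrite inE ls orbT.
  have -> : [set x | exists2 l, (l \in k :: s) && Q l & F l x] =
      F k `|` [set x | exists2 l, (l \in s) && Q l & F l x].
    apply/seteqP; split=> x.
      move=> [l /andP[+ Ql] Fl]; rewrite inE => /orP[/eqP lk|ls].
        by left; rewrite -lk.
      by right; exists l => //; rewrite ls.
    move=> [Fk|[l /andP[ls Ql] Fl]]; first by exists k => //; rewrite mem_head.
    by exists l => //; rewrite inE ls orbT.
  split; first by apply: measurableU; [exact: mF|exact: mS].
  rewrite measureU//; [by congr (_ + _)%E; exact: ES|exact: mF|].
  apply/seteqP; split=> x // [Fk [l /andP[ls Ql] Fl]].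
  by move: ks; rewrite (disj _ _ _ Qk Ql Fk Fl) ls.
have [_ <-] := H _ (index_enum_uniq K).
congr (mu _); apply/seteqP; split=> x [k Qk Fk]; exists k => //.
  by rewrite mem_index_enum.
by case/andP: Qk.
Qed.

Lemma measure_exists0 (K : finType) (F : K -> set T) :
  (forall k, measurable (F k)) -> (forall k, mu (F k) = 0%E) ->
  mu [set x | exists k, F k x] = 0%E.
Proof.
move=> mF F0.
have H (s : seq K) : measurable [set x | exists2 k, k \in s & F k x] /\
    mu [set x | exists2 k, k \in s & F k x] = 0%E.
  elim: s => [|k s [mS S0]].
    rewrite (_ : [set x | _] = set0); last by apply/seteqP; split=> x // [].
    by rewrite measure0.
  have -> : [set x | exists2 l, l \in k :: s & F l x] =
      F k `|` [set x | exists2 l, l \in s & F l x].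
    apply/seteqP; split=> x.
      move=> [l + Fl]; rewrite inE => /orP[/eqP lk|ls].
        by left; rewrite -lk.
      by right; exists l.
    move=> [Fk|[l ls Fl]]; first by exists k => //; rewrite mem_head.
    by exists l => //; rewrite inE ls orbT.
  split; first exact: measurableU.
  by rewrite measureU0 ?S0//; exact: F0.
rewrite -(H (index_enum K)).2; congr (mu _).
by apply/seteqP; split=> x [k]; [exists k; rewrite ?mem_index_enum|exists k].
Qed.

Lemma measure_eq_mod0 (A B N : set T) : measurable A -> measurable B ->
  measurable N -> mu N = 0%E -> A `<=` B `|` N -> B `<=` A `|` N -> mu A = mu B.
Proof.
move=> mA mB mN N0 AB BA; rewrite -(measureU0 mA mN N0) -(measureU0 mB mN N0).
congr (mu _); apply/seteqP; split=> x [h|h]; try by right.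
  exact: AB.
exact: BA.
Qed.

End FiniteAdditivity.

Lemma cap_chain_ext {R : realType} {I : finType} (A : {set I})
    (z z' : I -> R * R) : (forall j, j \in A -> z j = z' j) ->
  cap_chain A z -> cap_chain A z'.
Proof.
move=> E [H1 H2]; split; first by move=> j jA; rewrite -E//; exact: H1.
rewrite (_ : _ @` _ = z @` [set` A])//.
by apply/seteqP; split=> p [j /= jA <-]; exists j; rewrite ?E.
Qed.

Lemma cap_chain0 {R : realType} {I : finType} (z : I -> R * R) :
  cap_chain finset.set0 z.
Proof.
split=> [j|]; first by rewrite inE.
have H p : (z @` [set` finset.set0] `|` [set (0, 0); (1, 0)]) p -> p.1 = 0 \/ p.1 = 1.
  by move=> [[j /=]|[->|->]]; [rewrite inE|left|right].
move=> a b c /H[->|->] /H[->|->] /H[->|->] //; rewrite ?ltxx ?ltr10//.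
Qed.

(** * Splitting the law of the sample and solving the recursion *)

Section Sampling.
Context {R : realType} d (Omega : measurableType d) (P : probability Omega R).
Context (I : finType) (X : I -> Omega -> R * R).
Local Notation leb := (@lebesgue_measure R).
Local Notation area := (leb \x leb)%E.
Hypothesis mX : forall j, measurable_fun setT (X j).
Hypothesis iid : forall (A : {set I}) (B : I -> set (R * R)),
  (forall j, measurable (B j)) ->
  P [set w | forall j, j \in A -> B j (X j w)] =
  (\prod_(j in A) area (B j `&` @D R))%E.
Implicit Types A L : {set I}.

(** The part of [l * G] cut off by a chord stays inside [D], so intersecting its preimages with [D]
    loses no area. *)
Lemma rescale_in_D (l a b : R) (z : R * R) : 0 < l -> l <= 1 -> 0 <= a ->
  a < b -> b <= 1 -> @D R (rescale l a b z) -> @D R z.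
Proof.
move=> l0 l1 a0 ab b1; have ba : 0 < b - a by rewrite subr_gt0.
have s0 : 0 < l * (b - a) ^+ 2 by rewrite mulr_gt0// exprn_gt0.
rewrite /D /rescale /= => -[/andP[x0 x1] /andP[y0 y1]].
have {}x0 : a <= z.1.
  by move: x0; rewrite pmulr_lge0 ?invr_gt0// subr_ge0.
have {}x1 : z.1 <= b by move: x1; rewrite ler_pdivrMr// mul1r lerD2r.
have {}y0 : 6 * l * ((1 - a - b) * z.1 + a * b) <= z.2.
  by move: y0; rewrite pmulr_lge0 ?invr_gt0// subr_ge0.
have {}y1 : z.2 <= l * G z.1.
  move: y1; rewrite ler_pdivrMr// -subr_ge0 -[X in _ -> is_true X]subr_ge0.
  by congr (is_true (0 <= _)); rewrite /G; field; rewrite gt_eqF.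
have G0 : 0 <= G z.1.
  by rewrite /G !mulr_ge0//; lra.
(* The chord interpolates between the nonnegative values of the parabola at [a] and [b]. *)
have chord : 0 <= (1 - a - b) * z.1 + a * b.
  rewrite -(pmulr_rge0 _ ba).
  have -> : (b - a) * ((1 - a - b) * z.1 + a * b) =
    (b - z.1) * (a * (1 - a)) + (z.1 - a) * (b * (1 - b)) by ring.
  by apply: addr_ge0; apply: mulr_ge0; try apply: mulr_ge0; lra.
split; apply/andP; split; [lra|lra| |].
  by apply: le_trans y0; rewrite !mulr_ge0// ltW.
by apply: le_trans y1 _; rewrite ler_piMl.
Qed.

(** Restricted to the event that all rescaled points of [L] land in [D], their law is the original
    one times one area factor per point; this is checked on boxes and carried over by
    [law_unique]. *)
Lemma rescaled_prob L (l a b : R) : 0 < l -> l <= 1 -> 0 <= a -> a < b -> b <= 1 ->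
  P [set w | cap_chain L (rescale l a b \o X^~ w)] =
  (((l * (b - a) ^+ 3) ^+ #|L|)%:E * P [set w | cap_chain L (X^~ w)])%E.
Proof.
move=> l0 l1 a0 ab b1; have ba : 0 < b - a by rewrite subr_gt0.
pose c := l * (b - a) ^+ 3.
have c0 : 0 <= c ^+ #|L| by rewrite exprn_ge0// mulr_ge0// ?exprn_ge0// ltW.
pose Y j w := rescale l a b (X j w).
have mY j : measurable_fun setT (Y j).
  by apply: measurable_rescale => //; exact: measurable_cst.
have mfr : measurable_fun setT (rescale l a b : R * R -> R * R).
  by apply: measurable_rescale => //; exact: measurable_cst.
pose W := [set w | forall j, j \in L -> @D R (Y j w)].
have mW : measurable W.
  apply: measurable_forall => j; apply: measurable_imply => _.
  by have := mY j measurableT _ (@measurable_D R); rewrite setTI.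
have mE : @measurable _ (g_sigma_algebraType (boxes L)) [set z : I -> R * R | cap_chain L z].
  apply: (@measurable_cap_chain R _ (g_sigma_algebraType (boxes L)) I (fun j z => z j)) => j jL.
  exact: measurable_from_boxes.
transitivity (mrestr P mW [set w | cap_chain L (Y^~ w)]).
  rewrite /mrestr; congr (P _); apply/seteqP; split=> w /=; last by case.
  by move=> H; split => // j /H.1; exact: cap_sub_D.
transitivity (mscale (NngNum c0) P [set w | cap_chain L (X^~ w)]); last by [].
apply: (@law_unique R I _ _ L _ _ _ _ (mrestr P mW) (mscale (NngNum c0) P) Y X
  (fun j _ => mY j) (fun j _ => mX j) _ _ _ mE).
- by rewrite /= /mrestr setTI (@le_lt_trans _ _ 1%E) ?ltry// probability_le1.
- move=> B mB; rewrite /= /mscale /mrestr /= iid//.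
  have -> : [set w | forall j, j \in L -> B j (Y j w)] `&` W =
     [set w | forall j, j \in L -> (rescale l a b @^-1` (B j `&` @D R)) (X j w)].
    apply/seteqP; split=> w /= => [[H1 H2] j jL|H].
      by split; [exact: H1|exact: H2].
    by split=> j jL; case: (H j jL).
  rewrite (@iid L (fun j => rescale l a b @^-1` (B j `&` @D R))); last first.
    move=> j; have := mfr measurableT (B j `&` @D R); rewrite setTI; apply.
    by apply: measurableI => //; exact: measurable_D.
  transitivity (\prod_(j in L) (c%:E * area (B j `&` @D R)))%E.
    apply: eq_bigr => j jL; rewrite setIidl; last first.
      by move=> z /= [_ Dz]; exact: rescale_in_D Dz.
    by apply: area_rescale => //; apply: measurableI => //; exact: measurable_D.
  rewrite big_split /= prodEFin prodr_const.
  by [].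
Qed.

Let plane := (measurableTypeR R * measurableTypeR R)%type.
Let lawD : {measure set plane -> \bar R} := mrestr area (@measurable_D R).
Let PP : subprobability (Omega * Omega)%type R :=
  product_subprobability (P : subprobability Omega R, P : subprobability Omega R).
Let PPE S S' : measurable S -> measurable S' -> PP (S `*` S') = (P S * P S')%E.
Proof. by move=> mS mS'; exact: (product_measure1E P P). Qed.

Lemma split_prob A L i : i \in A -> L \subset A :\ i ->
  P [set w | split_chain A i L (X^~ w)] =
  (\int[area]_(z in [set z | in_cap z])
     (P [set w | cap_chain L (rescaleL z \o X^~ w)] *
      P [set w | cap_chain (A :\ i :\: L) (rescaleR z \o X^~ w)]))%E.
Proof.
move=> iA LA.
(* The highest point is read from the plane, the left points from one copy of the sample space and
   the right points from another. On boxes this has the law of [X], and the section at a fixed [z]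
   is a product event. *)
pose Y j (u : plane * (Omega * Omega)) : R * R :=
  if j == i then u.1 else if j \in L then X j u.2.1 else X j u.2.2.
have mY j : measurable_fun setT (Y j).
  rewrite /Y; case: (j == i); first exact: measurable_fst.
  case: (j \in L); apply: (measurableT_comp (mX j)).
    exact: (measurableT_comp measurable_fst measurable_snd).
  exact: (measurableT_comp measurable_snd measurable_snd).
have iL : i \notin L by apply/negP => /(fintype.subsetP LA); rewrite !inE eqxx.
have mE : @measurable _ (g_sigma_algebraType (boxes A)) [set z : I -> R * R | split_chain A i L z].
  apply: (@measurable_split_chain R _ (g_sigma_algebraType (boxes A)) I
    (fun j z => z j)) => // j jL.
  exact: measurable_from_boxes.
transitivity ((lawD \x PP)%E [set u | split_chain A i L (Y^~ u)]).
  apply: (@law_unique R I _ _ A _ _ _ _ P (lawD \x PP)%E X Y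
    (fun j _ => mX j) (fun j _ => mY j) _ _ _ mE).
    by apply: (@le_lt_trans _ _ 1%E); [exact: probability_le1|exact: ltry].
  move=> B mB; transitivity (\prod_(j in A) area (B j `&` @D R))%E; first exact: iid.
  have -> : [set u | forall j, j \in A -> B j (Y j u)] = B i `*`
      ([set w | forall j, j \in L -> B j (X j w)] `*`
       [set w | forall j, j \in (A :\ i) :\: L -> B j (X j w)]).
    apply/seteqP; split=> u /= => [H|[Hi [HL HR]] j jA].
      split; first by have := H _ iA; rewrite /Y eqxx.
      split=> j.
        move=> jL; have := fintype.subsetP LA _ jL; rewrite !inE => /andP[ji jA].
        by have := H _ jA; rewrite /Y (negbTE ji) jL.
      rewrite !inE => /andP[jL /andP[ji jA]].
      by have := H _ jA; rewrite /Y (negbTE ji) (negbTE jL).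
    rewrite /Y; case: eqP => [->//|/eqP ji].
    have [jL|jL] := boolP (j \in L); first exact: HL.
    by apply: HR; rewrite !inE jL ji jA.
  have mS (S : {set I}) : measurable [set w | forall j, j \in S -> B j (X j w)].
    apply: measurable_forall => j; apply: measurable_imply => _.
    by have := mX j measurableT (mB j); rewrite setTI.
  transitivity (lawD (B i) * (P [set w | forall j, j \in L -> B j (X j w)] *
    P [set w | forall j, j \in (A :\ i) :\: L -> B j (X j w)]))%E; last first.
    rewrite -PPE//; apply/esym; apply: product_measure1E; first exact: mB.
    by apply: measurableX; exact: mS.
  rewrite !iid// /lawD /= /mrestr.
  rewrite (big_setD1 i)//= (big_setID L)//=; congr (_ * (_ * _))%E.
  by apply: eq_bigl => j; rewrite (finset.setIidPr LA).
pose CL z := [set w | cap_chain L (rescaleL z \o X^~ w)].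
pose CR z := [set w | cap_chain (A :\ i :\: L) (rescaleR z \o X^~ w)].
have mCL z : measurable (CL z).
  apply: (measurable_cap_chain (X := fun j w => rescaleL z (X j w))) => j _.
  by apply: measurable_rescale => //; exact: measurable_cst.
have mCR z : measurable (CR z).
  apply: (measurable_cap_chain (X := fun j w => rescaleR z (X j w))) => j _.
  by apply: measurable_rescale => //; exact: measurable_cst.
have key z u : split_chain A i L (Y^~ (z, u)) <->
    in_cap z /\ (CL z `*` CR z) u.
  rewrite /split_chain; have -> : Y i (z, u) = z by rewrite /Y eqxx.
  have EL j : j \in L -> Y j (z, u) = X j u.1.
    by move=> jL; rewrite /Y jL; case: eqP => // ji; rewrite ji (negbTE iL) in jL.
  have ER j : j \in A :\ i :\: L -> Y j (z, u) = X j u.2.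
    by rewrite !inE => /andP[jL /andP[ji _]]; rewrite /Y (negbTE ji) (negbTE jL).
  split=> [[cz HL HR]|[cz [HL HR]]].
    split => //; split.
      by apply: cap_chain_ext HL => j /EL /= ->.
    by apply: cap_chain_ext HR => j /ER /= ->.
  split => //.
    by apply: cap_chain_ext HL => j /EL /= ->.
  by apply: cap_chain_ext HR => j /ER /= ->.
transitivity (\int[lawD]_z (((fun z => P (CL z) * P (CR z)) \_ [set z | in_cap z]) z))%E.
  apply: eq_integral => z _ /=; rewrite patchE.
  case: ifPn; rewrite ?notin_setE ?inE /= => cz.
    rewrite -(PPE (mCL z) (mCR z)).
    congr (PP _); apply/seteqP; split=> u; rewrite /xsection /= inE /=.
      by move/key=> [].
    by move=> H; apply/key.
  rewrite (_ : xsection _ z = set0) ?measure0//.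
  by apply/seteqP; split=> u //; rewrite /xsection /= inE /= => /key[].
rewrite -integral_mkcond; apply: eq_measure_integral => S mS Scap.
have SD : S `&` @D R = S.
  by apply: setIidl; apply: subset_trans Scap _; exact: cap_sub_D.
by transitivity (area (S `&` @D R)); [by []|rewrite SD].
Qed.

Lemma single_prob k (B : set (R * R)) : measurable B ->
  P [set w | B (X k w)] = area (B `&` @D R).
Proof.
move=> mB; have := @iid [set k]%SET (fun=> B) (fun=> mB).
rewrite big_set1 => <-; congr (P _); apply/seteqP; split=> w /=.
  by move=> Bw j; rewrite inE => /eqP ->.
by apply; rewrite inE.
Qed.

(** By [law_unique] the point [X j] may be replaced by an independent [z] with law [lawD]. For fixed
    [z] in the cap, the points tied with it have area 0. *)
Lemma tie_prob j k : j != k ->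
  P [set w | in_cap (X j w) /\ tie (X j w) (X k w)] = 0%E.
Proof.
move=> jk.
pose Y l (u : plane * Omega) : R * R := if l == j then u.1 else X k u.2.
have mY l : measurable_fun setT (Y l).
  rewrite /Y; case: (l == j); first exact: measurable_fst.
  exact: (measurableT_comp (mX k) measurable_snd).
pose A := [set j; k]%SET.
have jA : j \in A by rewrite !inE eqxx.
have kA : k \in A by rewrite !inE eqxx orbT.
have mE : @measurable _ (g_sigma_algebraType (boxes A))
   [set z : I -> R * R | in_cap (z j) /\ tie (z j) (z k)].
  apply: measurable_pred_and; apply: measurable_bool.
    by apply: measurable_in_cap; exact: measurable_from_boxes.
  by apply: measurable_tie; exact: measurable_from_boxes.
transitivity ((lawD \x P)%E [set u | in_cap (Y j u) /\ tie (Y j u) (Y k u)]).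
  apply: (@law_unique R I _ _ A _ _ _ _ P (lawD \x P)%E X Y
    (fun j _ => mX j) (fun j _ => mY j) _ _ _ mE).
    by apply: (@le_lt_trans _ _ 1%E); [exact: probability_le1|exact: ltry].
  move=> B mB; transitivity (\prod_(j in A) area (B j `&` @D R))%E; first exact: iid.
  have -> : [set u | forall l, l \in A -> B l (Y l u)] = B j `*`
      [set w | B k (X k w)].
    apply/seteqP; split=> u /= => [H|[Hj Hk] l].
      split; first by have := H _ jA; rewrite /Y eqxx.
      by have := H _ kA; rewrite /Y eq_sym (negbTE jk).
    by rewrite !inE => /orP[/eqP ->|/eqP ->]; rewrite /Y ?eqxx// eq_sym (negbTE jk).
  transitivity (lawD (B j) * P [set w | B k (X k w)])%E; last first.
    apply/esym; apply: product_measure1E; first exact: mB.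
    by have := mX k measurableT (mB k); rewrite setTI.
  by rewrite single_prob// big_setU1/= ?inE// big_set1.
rewrite [LHS]integral0_eq// => z _ /=.
have [cz|ncz] := boolP (in_cap z); last first.
  rewrite (_ : xsection _ z = set0) ?measure0//.
  apply/seteqP; split=> u //; rewrite /xsection /= inE /= /Y eqxx => -[] /= h.
  by rewrite h in ncz.
have mt : measurable [set w | tie z w].
  by apply: measurable_bool; apply: measurable_tie => //; exact: measurable_id.
rewrite -(area_tie cz) -(single_prob k mt); congr (P _).
apply/seteqP; split=> u; rewrite /xsection /= inE /= /Y eqxx eq_sym (negbTE jk).
  by case.
by [].
Qed.

Definition chain_prob (n : nat) : R := 12 ^+ n.+1 / (6 * (2 * n + 2)`!%:R).

Lemma measurable_chain A : measurable [set w | cap_chain A (X^~ w)].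
Proof. by apply: measurable_cap_chain => j _; exact: mX. Qed.

Let ties := [set w | exists p : I * I,
  p.1 != p.2 /\ in_cap (X p.1 w) /\ tie (X p.1 w) (X p.2 w)].

Lemma measurable_ties : measurable ties.
Proof.
apply: measurable_exists => p; apply: measurable_pred_and.
  by apply: measurable_bool; exact: measurable_cst.
by apply: measurable_pred_and; apply: measurable_bool;
  [exact: measurable_in_cap|exact: measurable_tie].
Qed.

Lemma ties_prob : P ties = 0%E.
Proof.
apply: (@measure_exists0 R _ _ P (I * I)%type (fun p => [set w |
   p.1 != p.2 /\ in_cap (X p.1 w) /\ tie (X p.1 w) (X p.2 w)])) => p.
  apply: measurable_pred_and; first by apply: measurable_bool; exact: measurable_cst.
  by apply: measurable_pred_and; apply: measurable_bool;
    [exact: measurable_in_cap|exact: measurable_tie].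
have [pp|pp] := eqVneq p.1 p.2.
  by rewrite (_ : [set w | _] = set0) ?measure0//; apply/seteqP; split=> w // [].
by rewrite -(tie_prob pp); congr (P _); apply/seteqP; split=> w //= [].
Qed.

Lemma split_value A L i : i \in A -> L \subset A :\ i ->
  P [set w | cap_chain L (X^~ w)] = (chain_prob #|L|)%:E ->
  P [set w | cap_chain (A :\ i :\: L) (X^~ w)] =
    (chain_prob #|A :\ i :\: L|)%:E ->
  P [set w | split_chain A i L (X^~ w)] =
  (6 / (#|A|)%:R * ((3 * #|L| + 1)`!%:R * (3 * (#|A|.-1 - #|L|) + 1)`!%:R /
     (3 * #|A|)`!%:R) * (chain_prob #|L| * chain_prob (#|A|.-1 - #|L|)))%:E.
Proof.
move=> iA LA PL PR; have cA := cardsD1 i A; rewrite iA add1n in cA.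
have cR : #|A :\ i :\: L| = (#|A|.-1 - #|L|)%N.
  by rewrite cardsD (finset.setIidPr LA) cA.
have kn : (#|L| + (#|A|.-1 - #|L|) = #|A|.-1)%N.
  by rewrite subnKC// cA /=; exact: subset_leq_card.
rewrite split_prob//.
set k := #|L|; set m := (#|A|.-1 - #|L|)%N.
have mc : measurable [set z : R * R | in_cap z] by exact: measurable_cap.
pose h (z : R * R) : R := (height z * z.1 ^+ 3) ^+ k * (height z * (1 - z.1) ^+ 3) ^+ m.
transitivity (\int[area]_(z in [set z | in_cap z])
   ((chain_prob k * chain_prob m)%:E * (h z)%:E))%E.
  apply: eq_integral => z; rewrite inE /= => cz; have /and4P[z0 z1 _ _] := cz.
  rewrite rescaled_prob ?height_gt0 ?(ltW (height_lt1 cz)) ?(ltW z1)//.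
  rewrite rescaled_prob ?height_gt0 ?(ltW (height_lt1 cz)) ?(ltW z0)//.
  rewrite PL PR cR -/k -/m -!EFinM /h subr0; congr (_%:E); ring.
have p0 n : 0 <= chain_prob n by rewrite divr_ge0 ?exprn_ge0// mulr_ge0.
rewrite ge0_integralZl//; last 3 first.
- apply/measurable_EFinP; apply: measurable_funS (measurableT) _ _ => //.
  have mH := measurable_height (@measurable_id _ (R * R)%type setT).
  by apply: measurable_funM; apply: measurable_funX; apply: measurable_funM => //;
    apply: measurable_funX => //; exact: measurable_funB.
- move=> z cz; have /and4P[z0 z1 _ _] := cz; have hz := ltW (height_gt0 cz).
  by rewrite lee_fin /h; apply: mulr_ge0; apply: exprn_ge0; apply: mulr_ge0 => //;
    apply: exprn_ge0; rewrite ?subr_ge0 ltW.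
- by rewrite lee_fin mulr_ge0.
by rewrite integral_cap -EFinM kn cA /= mulrC.
Qed.

Lemma sum_subsets (S : {set I}) (f : nat -> R) :
  \sum_(L : {set I} | L \subset S) f #|L| =
  \sum_(k < #|S|.+1) 'C(#|S|, k)%:R * f k.
Proof.
rewrite (partition_big (fun L : {set I} => inord #|L| : 'I_#|S|.+1) xpredT)//=.
apply: eq_bigr => k _.
rewrite (eq_bigl (fun L : {set I} => L \in [set L : {set I} | L \subset S & #|L| == k]%SET)).
  rewrite (eq_bigr (fun=> f k)); last by move=> L; rewrite inE => /andP[_ /eqP ->].
  by rewrite big_const iter_addr addr0 cards_draws mulr_natl.
move=> L; rewrite inE; have [LS|//] := boolP (L \subset S).
by rewrite -val_eqE /= inordK// ltnS; exact: subset_leq_card.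
Qed.

(** Up to [ties], the chain event is the disjoint union of the split events over all [i] and [L].
    Both sides of a split have fewer points than [A], so strong induction on the cardinal applies to
    them. *)
Lemma chain_probE A : P [set w | cap_chain A (X^~ w)] = (chain_prob #|A|)%:E.
Proof.
have [n] := ubnP #|A|; elim: n A => // n IH A; rewrite ltnS => An.
have [->|A0] := eqVneq A finset.set0.
  rewrite (_ : [set w | _] = setT); last first.
    by apply/seteqP; split=> w // _; exact: cap_chain0.
  rewrite probability_setT cards0 /chain_prob; congr (_%:E).
  by rewrite muln0 add0n /factorial /=; field.
pose Q (p : I * {set I}) := (p.1 \in A) && (p.2 \subset A :\ p.1).
have splitM p : Q p -> measurable [set w | split_chain A p.1 p.2 (X^~ w)].
  by move=> /andP[h1 h2]; apply: measurable_split_chain => // j _; exact: mX.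
have Qsplit : [set w | exists2 p, Q p & split_chain A p.1 p.2 (X^~ w)] =
   [set w | exists p, Q p /\ split_chain A p.1 p.2 (X^~ w)].
  by apply/seteqP; split=> w [p]; [exists p|case; exists p].
transitivity (P [set w | exists2 p, Q p & split_chain A p.1 p.2 (X^~ w)]).
  apply: (measure_eq_mod0 (N := ties)); [exact: measurable_chain| |exact: measurable_ties
    |exact: ties_prob| |].
  - rewrite Qsplit; apply: measurable_exists => p.
    have [Qp|nQp] := boolP (Q p).
      rewrite (_ : [set w | _] = [set w | split_chain A p.1 p.2 (X^~ w)]).
        exact: splitM.
      by apply/seteqP; split=> w //= [].
    by rewrite (_ : [set w | _] = set0)//; apply/seteqP; split=> w // [].
  - move=> w Hw; have [tw|ntw] := pselect (ties w); [by right|left].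
    have [|i [L [iA LA H]]] := cap_chain_split A0 Hw.
      move=> j k jA kA jk; apply/negP => t; apply: ntw; exists (j, k).
      by split => //; split => //; exact: Hw.1.
    by exists (i, L) => //; rewrite /Q iA.
  - by move=> w [p /andP[h1 h2] H]; left; exact: split_chain_cap H.
rewrite measure_exists//; last first.
  move=> [i L] [i' L'] w /andP[/= iA LA] /andP[/= iA' LA'] H H'.
  by have [-> ->] := split_chain_inj iA LA iA' LA' H H'.
have cA i : i \in A -> #|A :\ i| = #|A|.-1 by move=> iA; rewrite (cardsD1 i A) iA.
have A1 : (0 < #|A|)%N by rewrite card_gt0.
pose N := #|A|.-1; have AN : #|A| = N.+1 by rewrite prednK.
pose f k : R := 6 / N.+1%:R * ((3 * k + 1)`!%:R * (3 * (N - k) + 1)`!%:R /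
     (3 * N.+1)`!%:R) * (chain_prob k * chain_prob (N - k)).
transitivity (\sum_(p | Q p) (f #|p.2|)%:E)%E.
  apply: eq_bigr.
  move=> [i L] /andP[/= iA LA].
  have lL : (#|L| < n)%N.
    by apply: leq_trans An; rewrite AN ltnS -[N](cA _ iA); exact: subset_leq_card.
  have lR : (#|A :\ i :\: L| < n)%N.
    apply: leq_trans An; rewrite AN ltnS -[N](cA _ iA); apply: subset_leq_card.
    exact: subsetDl.
  by rewrite split_value ?IH// /f -/N AN.
rewrite sumEFin; congr (_%:E).
rewrite (eq_bigl (fun p : I * {set I} => (p.1 \in A) && (p.2 \subset A :\ p.1)))//.
rewrite -(pair_big_dep (mem A) (fun i L => L \subset A :\ i) (fun _ L => f #|L|)) /=.
rewrite (eq_bigr (fun=> \sum_(k < N.+1) 'C(N, k)%:R * f k)); last first.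
  by move=> i iA; rewrite sum_subsets cA.
(* Each choice of the highest index contributes equally; their number [N.+1] cancels the denominator
   produced by integrating over the height. *)
rewrite big_const iter_addr addr0 AN -mulr_natl.
rewrite /chain_prob -chain_prob_recurrence mulr_sumr mulr_sumr.
apply: eq_bigr => k _; rewrite /f /chain_prob.
set a := 12 ^+ _ / _; set b := 12 ^+ _ / _.
have h1 : (3 * N.+1)`!%:R != 0 :> R by rewrite pnatr_eq0 -lt0n fact_gt0.
have h2 : N.+1%:R != 0 :> R by rewrite pnatr_eq0.
move: ((3 * N.+1)`!%:R) (N.+1%:R : R) h1 h2 => c e h1 h2.
by field; rewrite h1 h2.
Qed.

End Sampling.

(** * From independent uniform points and convex position to chains *)

Lemma uniform_boxes (R : realType) (d : measure_display)
    (Omega : measurableType d) (P : probability Omega R) (I : finType)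
    (X : I -> {RV P >-> (R * R)%type}) (A : {set I}) (B : I -> set (R * R)) :
  mutually_independent X -> (forall i, uniform_in (X i) (@D R)) ->
  (forall j, measurable (B j)) ->
  P [set w | forall j, j \in A -> B j (X j w)] =
  (\prod_(j in A) (@lebesgue_measure R \x @lebesgue_measure R) (B j `&` @D R))%E.
Proof.
move=> ind unif mB.
transitivity (P (\bigcap_(i in [set` A]) (X i @^-1` B i))); first by [].
rewrite ind//; apply: eq_bigr => j _.
by have := unif j _ (mB j); rewrite /distribution /pushforward area_D inve1 mule1.
Qed.

(** The two events differ only inside [ties] and [off]. A tie matters here through equal abscissas,
    where a concave chain need not be in convex position; [i0] supplies a point off the axis,
    without which there is no polygon. *)
Lemma position_prob (R : realType) (d : measure_display)
    (Omega : measurableType d) (P : probability Omega R) (I : finType) (i0 : I)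
    (X : I -> {RV P >-> (R * R)%type}) :
  mutually_independent X -> (forall i, uniform_in (X i) (@D R)) ->
  P [set w | in_convex_position
       ([set X i w | i in [set: I]] `|` [set (0, 0); (1, 0)])] =
  P [set w | cap_chain [set: I]%SET (fun i => X i w)].
Proof.
move=> ind unif.
have mX i : measurable_fun setT (X i : Omega -> R * R) by exact: measurable_funPT.
have iid A B := @uniform_boxes R d Omega P I X A B ind unif.
pose ties := [set w | exists p : I * I,
  p.1 != p.2 /\ in_cap (X p.1 w) /\ tie (X p.1 w) (X p.2 w)].
pose off := [set w | exists i, ~~ in_cap (X i w)].
have mc i : measurable [set w | ~~ in_cap (X i w)].
  by apply: measurable_bool; apply: measurable_neg; exact: measurable_in_cap.
have moff : measurable off by exact: measurable_exists.
have off0 : P off = 0%E.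
  apply: (measure_exists0 (F := fun i => [set w | ~~ in_cap (X i w)])) => // i.
  have mn : measurable [set z : R * R | ~~ in_cap z].
    by apply: measurable_bool; apply: measurable_neg; apply: measurable_in_cap; exact: measurable_id.
  apply: etrans (single_prob iid i mn) _.
  rewrite -(@area_D_cap R); congr (_ _).
  by apply/seteqP; split=> z [h1 h2]; split => //; apply/negP.
have mties : measurable ties by exact: (measurable_ties mX).
have ties0 : P ties = 0%E by exact: (ties_prob mX iid).
have E w : [set X i w | i in [set: I]] = (fun i => X i w) @` [set` [set: I]%SET].
  by congr (_ @` _); apply/seteqP; split=> i //= _; rewrite inE.
apply: (measure_eq_mod0 (N := ties `|` off)).
- exact: (measurable_position mX).
- exact: (measurable_chain mX).
- exact: measurableU.
- by rewrite measureU0.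
- move=> w Hw; have [nw|nw] := pselect ((ties `|` off) w); [by right|left].
  have capw i : in_cap (X i w).
    by apply/negPn/negP => h; apply: nw; right; exists i.
  by split => //; rewrite -E; exact: position_chain.
- move=> w [capw Hw]; have [nw|nw] := pselect ((ties `|` off) w); [by right|left].
  have {}capw i : in_cap (X i w) by apply: capw; rewrite inE.
  rewrite -E in Hw; apply: (chain_position i0) => // j k jk.
  apply/negP => e; apply: nw; left; exists (j, k).
  by do 2?split => //=; rewrite /tie e.
Qed.

Theorem theorem5 (R : realType) (n : nat) (d : measure_display)
    (Omega : measurableType d) (P : probability Omega R)
    (X : 'I_n -> {RV P >-> (R * R)%type})
    (X_indep : mutually_independent X)
    (X_unif : forall i : 'I_n, uniform_in (X i) (@D R)) :
  prob_convex X = (12 ^+ n.+1 / (6 * ((2 * n + 2)`!)%:R))%:E.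
Proof.
rewrite /prob_convex; case: n => [|n] /= in X X_indep X_unif *.
  (* The convention [p_0 = 1] agrees with the formula: [12 / (6 * 2!) = 1]. *)
  by congr (_%:E); rewrite muln0 add0n /factorial /=; field.
rewrite (position_prob ord0 X_indep X_unif).
have mX i : measurable_fun setT (X i : Omega -> R * R) by exact: measurable_funPT.
rewrite (chain_probE mX); last by move=> A B; exact: uniform_boxes.
by rewrite cardsT card_ord.
Qed.
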